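(* Let $\Phi$ be an irreducible root system with positive roots $\Phi^+$, and let $q$ be a power of a prime $p$ with $p>2$ if $\Phi$ is of type $B_m$, $C_m$ ($m\ge2$) or $F_4$, and $p>3$ if $\Phi$ is of type $G_2$. For a subset $\Sigma\subseteq\Phi^+$ the following are equivalent: (a) $\Sigma$ is representable. (b) $\Sigma$ is an antichain of the root poset $(\Phi^+,\preceq)$.
   Context: $Y_n(q)$ is the untwisted Chevalley group over $\mathbb{F}_q$ with root system $\Phi$ (of Dynkin type $Y$ and rank $n$), with root subgroups $X_\gamma$, and $UY_n=\langle X_\gamma\mid\gamma\in\Phi^+\rangle$. For $\chi\in\operatorname{Irr}(UY_n)$ (complex irreducible characters) put $\operatorname{rs}(\chi)=\{\gamma\in\Phi^+\mid X_\gamma\subseteq Z(\chi),\ X_\gamma\not\subseteq\ker\chi\}$. A subset $\Sigma\subseteq\Phi^+$ is representable if $\Sigma=\operatorname{rs}(\chi)$ for some $\chi\in\operatorname{Irr}(UY_n)$. The partial order: $\alpha\preceq\beta$ if $\beta-\alpha$ is $0$ or a sum of positive roots. An antichain is a subset whose elements are pairwise incomparable. *)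

(* Defs.v *)
From HB Require Import structures.
From mathcomp Require Import all_boot all_order all_algebra all_fingroup.
From mathcomp Require Import all_solvable all_field all_character finmap reals.

Set Implicit Arguments.
Unset Strict Implicit.
Unset Printing Implicit Defensive.

Import Order.TTheory GRing.Theory Num.Theory.
Local Open Scope fset_scope.
Local Open Scope ring_scope.

(* ------------------------------ Root systems ------------------------------ *)

Section RootSystem.
Variables (R : realType) (n : nat).
Local Notation V := 'rV[R]_n.

Definition dot (u v : V) : R := \sum_i u 0 i * v 0 i.

(* <a, b^vee> = 2 (a, b) / (b, b) *)
Definition cartan (a b : V) : R := 2 * dot a b / dot b b.

Definition reflection (a v : V) : V := v - cartan v a *: a.

(* Reduced crystallographic root system of rank n in the Euclidean space R^n. *)
Record root_system (Phi : {fset V}) : Prop := RootSystem {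
  root_span : <<enum_fset Phi>>%VS = fullv;
  root_neq0 : 0 \notin Phi;
  root_reduced : forall (a : V) (c : R),
    a \in Phi -> c *: a \in Phi -> c = 1 \/ c = -1;
  root_reflection : forall a b : V,
    a \in Phi -> b \in Phi -> reflection a b \in Phi;
  root_integral : forall a b : V,
    a \in Phi -> b \in Phi -> cartan a b \is a Num.int }.

Definition irreducible_roots (Phi : {fset V}) : Prop :=
  Phi <> fset0 /\
  forall A : {fset V}, A `<=` Phi ->
    (forall a b : V, a \in A -> b \in Phi `\` A -> dot a b = 0) ->
    A = fset0 \/ A = Phi.

Definition root_base (Phi : {fset V}) (Delta : n.-tuple V) : Prop :=
  [/\ basis_of fullv Delta, {subset Delta <= Phi} &
      forall a : V, a \in Phi ->
        (forall i, coord Delta i a \is a Num.nat) \/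
        (forall i, - coord Delta i a \is a Num.nat)].

Definition pos_roots (Phi : {fset V}) (Delta : n.-tuple V) : {fset V} :=
  [fset a in Phi | [forall i, 0 <= coord Delta i a]].

(* The empty list of positive roots accounts for the case b - a = 0. *)
Definition root_le (Phi : {fset V}) (Delta : n.-tuple V) (a b : V) : Prop :=
  exists2 s : seq V, {subset s <= pos_roots Phi Delta} & b - a = \sum_(x <- s) x.

Definition root_antichain (Phi : {fset V}) (Delta : n.-tuple V)
    (Sigma : {fset V}) : Prop :=
  forall a b : V, a \in Sigma -> b \in Sigma -> a <> b ->
    ~ root_le Phi Delta a b /\ ~ root_le Phi Delta b a.

(* M is the Cartan matrix (<alpha_i, alpha_j^vee>)_(i,j) for some ordering of
   the simple roots; indices start at 0. *)
Definition has_cartan_matrix (Delta : n.-tuple V) (M : nat -> nat -> int) : Prop :=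
  exists s : 'S_n, forall i j : 'I_n,
    cartan (tnth Delta (s i)) (tnth Delta (s j)) = (M i j)%:~R.

(* Chain i -- i+1, with the entry at position (k, l) replaced by c. *)
Definition chain_cartan (k l : nat) (c : int) (i j : nat) : int :=
  if (i == k) && (j == l) then c
  else if i == j then 2
  else if (j == i.+1) || (i == j.+1) then -1
  else 0.

(* In type B the last simple root is the short one, in type C the long one;
   in type F_4 the first two are long; in type G_2 the first one is short. *)
Definition type_B (Delta : n.-tuple V) : Prop :=
  (2 <= n)%N /\ has_cartan_matrix Delta (chain_cartan n.-2 n.-1 (-2)).
Definition type_C (Delta : n.-tuple V) : Prop :=
  (2 <= n)%N /\ has_cartan_matrix Delta (chain_cartan n.-1 n.-2 (-2)).
Definition type_F4 (Delta : n.-tuple V) : Prop :=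
  n = 4%N /\ has_cartan_matrix Delta (chain_cartan 1 2 (-2)).
Definition type_G2 (Delta : n.-tuple V) : Prop :=
  n = 2%N /\ has_cartan_matrix Delta (chain_cartan 1 0 (-3)).

End RootSystem.

(* ----------------------- Lie algebra, Chevalley basis ---------------------- *)

Record lie_bracket (K : fieldType) (L : vectType K) (br : L -> L -> L) : Prop :=
  LieBracket {
    lie_linearl : forall y : L, linear (br^~ y);
    lie_linearr : forall x : L, linear (br x);
    lie_alternating : forall x : L, br x x = 0;
    lie_jacobi : forall x y z : L,
      br x (br y z) + br y (br z x) + br z (br x y) = 0 }.

Section Chevalley.
Variables (R : realType) (n : nat).
Local Notation V := 'rV[R]_n.
Variables (Phi : {fset V}) (Delta : n.-tuple V).
Variables (L : vectType algC) (br : L -> L -> L) (e : V -> L).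

Definition coroot_vec (a : V) : L := br (e a) (e (- a)).

(* The vectors h_a (a simple) followed by the e_a (a a root). *)
Definition chevalley_seq : seq L :=
  [seq coroot_vec a | a <- Delta] ++ [seq e a | a <- enum_fset Phi].

(* chevalley_seq is a Chevalley basis of the complex simple Lie algebra
   (L, br) with root system Phi, in the sense of Chevalley's basis theorem:
   N_(a,b) = +-(r + 1) where r is the largest natural number such that
   b - r a is a root. *)
Record chevalley_basis : Prop := ChevalleyBasis {
  chev_lie : lie_bracket br;
  chev_basis : basis_of fullv chevalley_seq;
  chev_hh : forall a b : V, a \in Phi -> b \in Phi ->
    br (coroot_vec a) (coroot_vec b) = 0;
  chev_he : forall a b : V, a \in Phi -> b \in Phi ->
    br (coroot_vec a) (e b) = (Num.floor (cartan b a))%:~R *: e b;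
  chev_ee0 : forall a b : V, a \in Phi -> b \in Phi ->
    a + b != 0 -> a + b \notin Phi -> br (e a) (e b) = 0;
  chev_ee : forall (a b : V) (r : nat),
    a \in Phi -> b \in Phi -> a + b \in Phi ->
    b - a *+ r \in Phi -> (forall k : nat, (r < k)%N -> b - a *+ k \notin Phi) ->
    br (e a) (e b) = r.+1%:R *: e (a + b) \/
    br (e a) (e b) = - (r.+1%:R *: e (a + b)) }.

(* --------------- Root subgroups of the Chevalley group over F -------------- *)

Variable F : finFieldType.

Local Notation d := (size chevalley_seq).

(* Matrix of (ad e_a)^k / k! in the Chevalley basis (row i is the image of the
   i-th basis vector), reduced from Z to F. For a Chevalley basis its entries
   are integers, so that Num.floor loses nothing. *)
Definition divided_ad_mx (a : V) (k : nat) : 'M[F]_d :=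
  \matrix_(i < d, j < d)
    (Num.floor (coord (in_tuple chevalley_seq) j
       (k`!%:R^-1 *: iter k (br (e a)) (tnth (in_tuple chevalley_seq) i))))%:~R.

(* x_a(t) = exp (t ad e_a), acting on F (x) L_Z, identified with row vectors.
   The sum stops at d = dim L because ad e_a is nilpotent. *)
Definition root_elt_mx (a : V) (t : F) : 'M[F]_d :=
  \sum_(k < d) t ^+ k *: divided_ad_mx a k.

(* X_a = {x_a(t) | t in F}, as a set of permutations of F (x) L_Z. *)
Definition root_subgroup (a : V) : {set {perm 'rV[F]_d}} :=
  [set u : {perm 'rV[F]_d} |
    [exists t : F, [forall v, u v == v *m root_elt_mx a t]]].

(* UY_n, as a subgroup of the adjoint Chevalley group <X_a | a \in Phi>; up to
   isomorphism, UY_n and its root subgroups do not depend on the isogeny type. *)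
Definition UY : {group {perm 'rV[F]_d}} :=
  <<\bigcup_(a : pos_roots Phi Delta) root_subgroup (val a)>>%G.

Definition rs (i : Iirr UY) : {fset V} :=
  [fset a in pos_roots Phi Delta |
    (root_subgroup a \subset 'Z('chi_i)%CF) &&
    ~~ (root_subgroup a \subset cfker 'chi_i)].

Definition representable (Sigma : {fset V}) : Prop :=
  exists i : Iirr UY, rs i = Sigma.

End Chevalley.

(* Main.v *)
Require Import Defs.
From mathcomp Require Import all_boot all_order all_algebra all_fingroup.
From mathcomp Require Import all_solvable all_field all_character finmap reals.
From mathcomp Require Import ring lra zify.

Set Implicit Arguments.
Unset Strict Implicit.
Unset Printing Implicit Defensive.

Import Order.TTheory GRing.Theory Num.Theory.
Local Open Scope fset_scope.
Local Open Scope ring_scope.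

(** Why the theorem holds. Order the weights by the cone spanned by the simple
    roots. The group U acts on the span over F of a Chevalley basis, which is
    graded by the weights (the roots and 0), and an element u of U is 1 plus
    matrix components of positive weight; in a root element x_a(t) these are
    t ad e_a, of weight a, and components whose weights are higher multiples
    of a. For an upper set S of positive weights, the elements congruent to 1
    up to components of weights in S form a normal subgroup of U, without any
    appeal to commutator formulas ([congr_sub_norm]).

    An antichain is representable ([antichain_character]). Let J be the normal
    subgroup of the elements congruent to 1 up to weights that are not below
    any root of Sigma. The roots of Sigma being maximal among the other
    weights, the X_a with a in Sigma are central modulo J, and the coefficients
    of the ad e_a add up to a homomorphism to F from the group of the elements
    that also have components of weights in Sigma. So this group has an
    irreducible character trivial on J and nontrivial on each X_a; any
    constituent chi of the character induced to U represents Sigma. Indeed a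
    root outside Sigma either has its root subgroup in J, or lies below an
    element of Sigma, which the other implication excludes.

    Roots of rs(chi) are incomparable ([comparable_cfker]). If X_a is central
    modulo the kernel and g is a root above a, then g is reached from a by
    adding simple roots one at a time, the intermediate sums being roots
    ([chain_ind]). Iterated commutators with simple root elements then give
    elements of the kernel with leading term t ad e_g for every t, because the
    structure constants +-(r + 1) met on the way are nonzero in F
    ([string_coef_prime]). Taking g of maximal height with X_g not in the
    kernel, the terms above g are absorbed by the kernel provided that an
    element congruent to 1 up to weights above g is a product of elements of
    root subgroups X_b with b above g ([UY_gen]).

    That last fact may fail for automorphisms of the Lie algebra over F, which
    can have leading terms that are outer derivations. It is proved by lifting
    u to an automorphism M over Z[X], of which F is a quotient. The component
    of M of minimal weight w is a derivation of weight w, and evaluating it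
    at a Cartan element shows that it is c ad e_w ([lead_root]); the
    coefficient c is in Z[X] because the coordinates of a coroot on the simple
    coroots have a Bezout relation ([coroot_coord]). Multiplying by x_w(-c)
    removes this component ([lift_gen]).

    The hypotheses on p enter through [string_coef_prime] only. If r >= 1, or
    r >= 2, there are roots of squared length ratio different from 1, or equal
    to 3, so the Dynkin diagram has a multiple edge; such a diagram is of type
    B, C, F_4 or G_2, because in any other diagram a suitable nonnegative
    combination of simple roots would have norm at most 0 ([double_edge],
    [triple_edge]). *)

(** * Inner products and Cartan integers *)

Section InnerProduct.
Variables (R : realType) (n : nat).
Local Notation V := 'rV[R]_n.
Implicit Types u v w : V.

Lemma dotC u v : dot u v = dot v u.
Proof. by apply: eq_bigr => i _; rewrite mulrC. Qed.

Lemma dotDl u v w : dot (u + v) w = dot u w + dot v w.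
Proof. by rewrite -big_split; apply: eq_bigr => i _; rewrite mxE mulrDl. Qed.

Lemma dotZl c u v : dot (c *: u) v = c * dot u v.
Proof. by rewrite mulr_sumr; apply: eq_bigr => i _; rewrite mxE mulrA. Qed.

Lemma dotNl u v : dot (- u) v = - dot u v.
Proof. by rewrite -scaleN1r dotZl mulN1r. Qed.

Lemma dot0l v : dot 0 v = 0.
Proof. by rewrite -(scale0r 0) dotZl mul0r. Qed.

Lemma dotDr u v w : dot w (u + v) = dot w u + dot w v.
Proof. by rewrite ![dot w _]dotC dotDl. Qed.

Lemma dotZr c u v : dot u (c *: v) = c * dot u v.
Proof. by rewrite ![dot u _]dotC dotZl. Qed.

Lemma dotNr u v : dot u (- v) = - dot u v.
Proof. by rewrite ![dot u _]dotC dotNl. Qed.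

Lemma dot_suml I (r : seq I) (P : pred I) (f : I -> V) v :
  dot (\sum_(i <- r | P i) f i) v = \sum_(i <- r | P i) dot (f i) v.
Proof.
elim/big_rec2: _ => [|i x y _ IH]; first by rewrite dot0l.
by rewrite dotDl IH.
Qed.

Lemma dot_sumr I (r : seq I) (P : pred I) (f : I -> V) v :
  dot v (\sum_(i <- r | P i) f i) = \sum_(i <- r | P i) dot v (f i).
Proof. by rewrite dotC dot_suml; apply: eq_bigr => i _; rewrite dotC. Qed.

Lemma dot_ge0 v : 0 <= dot v v.
Proof. by apply: sumr_ge0 => i _; rewrite -expr2 sqr_ge0. Qed.

Lemma dot_eq0 v : (dot v v == 0) = (v == 0).
Proof.
apply/eqP/eqP => [|->]; last by rewrite dot0l.
move=> /eqP; rewrite psumr_eq0 => [/allP v0|i _]; last by rewrite -expr2 sqr_ge0.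
apply/rowP=> i; rewrite mxE; apply/eqP.
by have := v0 i (mem_index_enum _); rewrite /= -expr2 sqrf_eq0.
Qed.

Lemma dot_gt0 v : (0 < dot v v) = (v != 0).
Proof. by rewrite lt_def dot_ge0 andbT dot_eq0. Qed.

(** The vector |a|^2 b - (a,b) a is orthogonal to a and vanishes only when a
    and b are proportional; its squared norm is |a|^2 times the difference of
    the two sides. *)
Lemma dot_cauchy_lt (a b : V) : a != 0 -> (forall c, b != c *: a) ->
  dot a b ^+ 2 < dot a a * dot b b.
Proof.
move=> a0 nprop; have aa : 0 < dot a a by rewrite dot_gt0.
pose w := dot a a *: b - dot a b *: a.
have w0 : w != 0.
  rewrite subr_eq0; apply: contra (nprop (dot a b / dot a a)) => /eqP e.
  apply/eqP; apply: (scalerI (lt0r_neq0 aa)); rewrite e scalerA.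
  by rewrite mulrC divfK ?lt0r_neq0.
have : 0 < dot w w by rewrite dot_gt0.
have -> : dot w w = dot a a * (dot a a * dot b b - dot a b ^+ 2).
  by rewrite /w !(dotDl, dotDr, dotNl, dotNr, dotZl, dotZr) (dotC b a); ring.
by rewrite pmulr_rgt0 // subr_gt0.
Qed.

End InnerProduct.

Section Roots.
Variables (R : realType) (n : nat).
Local Notation V := 'rV[R]_n.
Variables (Phi : {fset V}) (Delta : n.-tuple V).
Hypotheses (rsP : root_system Phi) (baseP : root_base Phi Delta).
Implicit Types a b g d u v w x : V.

Local Notation cf := (coord Delta).
Local Notation al := (tnth Delta).

Lemma root_nz a : a \in Phi -> a != 0.
Proof. by apply: contraTneq => ->; apply: root_neq0 rsP. Qed.

Lemma root_dot_gt0 a : a \in Phi -> 0 < dot a a.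
Proof. by move=> /root_nz; rewrite dot_gt0. Qed.

Definition cartan_int a b : int := Num.floor (cartan a b).

Lemma zcE a b : a \in Phi -> b \in Phi -> (cartan_int a b)%:~R = cartan a b.
Proof. by move=> ha hb; apply/eqP; rewrite -intrEfloor; apply: root_integral rsP _ _ ha hb. Qed.

Lemma zc_dot a b : a \in Phi -> b \in Phi ->
  (cartan_int a b)%:~R * dot b b = 2 * dot a b.
Proof.
move=> ha hb; rewrite zcE // /cartan divfK // lt0r_neq0 //.
exact: root_dot_gt0.
Qed.

Lemma zcaa a : a \in Phi -> cartan_int a a = 2.
Proof.
move=> ha; apply: (@intr_inj R); apply: (mulIf (lt0r_neq0 (root_dot_gt0 ha))).
by rewrite zc_dot.
Qed.

Lemma root_opp a : a \in Phi -> - a \in Phi.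
Proof.
move=> ha; have := root_reflection rsP ha ha.
by rewrite /reflection -zcE // zcaa // scaler_nat mulr2n opprD addNKr.
Qed.

Lemma zc_refl a b : a \in Phi -> b \in Phi -> b - (cartan_int b a)%:~R *: a \in Phi.
Proof. by move=> ha hb; rewrite zcE //; apply: root_reflection rsP _ _ ha hb. Qed.

Lemma root_prop a b c : a \in Phi -> b \in Phi -> b = c *: a -> b = a \/ b = - a.
Proof.
move=> ha hb e; rewrite e in hb *.
by case: (root_reduced rsP ha hb) => ->; [left; rewrite scale1r | right; rewrite scaleN1r].
Qed.

(** By the strict Cauchy-Schwarz inequality, the product of the two Cartan
    integers of non-proportional roots is 4 cos^2 < 4. *)
Lemma zc_mul_lt4 a b : a \in Phi -> b \in Phi -> b != a -> b != - a ->
  cartan_int a b * cartan_int b a < 4.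
Proof.
move=> ha hb /eqP ba /eqP bNa; rewrite -(ltr_int R) rmorphM /=.
have aa := root_dot_gt0 ha; have bb := root_dot_gt0 hb.
rewrite -(ltr_pM2r (mulr_gt0 aa bb)).
have -> : (cartan_int a b)%:~R * (cartan_int b a)%:~R * (dot a a * dot b b) =
  ((cartan_int a b)%:~R * dot b b) * ((cartan_int b a)%:~R * dot a a) :> R by ring.
rewrite !zc_dot // (dotC b a).
have : dot a b ^+ 2 < dot a a * dot b b.
  apply: dot_cauchy_lt => [|c]; first exact: root_nz.
  by apply/eqP => e; case: (root_prop ha hb e).
by rewrite expr2; lra.
Qed.

Lemma zc_sgn a b : a \in Phi -> b \in Phi ->
  ((0 < cartan_int a b) = (0 < dot a b)) * ((cartan_int a b < 0) = (dot a b < 0)).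
Proof.
move=> ha hb; rewrite -!(ltr_int R); have bb := root_dot_gt0 hb.
split; first by rewrite -(pmulr_lgt0 _ bb) zc_dot // pmulr_rgt0 // ltr0n.
by rewrite -(pmulr_llt0 _ bb) zc_dot // pmulr_rlt0 // ltr0n.
Qed.

Lemma zc_neg_sym a b : a \in Phi -> b \in Phi -> (cartan_int a b < 0) = (cartan_int b a < 0).
Proof. by move=> ha hb; rewrite !zc_sgn // dotC. Qed.

Lemma zc_pos_sym a b : a \in Phi -> b \in Phi -> (0 < cartan_int a b) = (0 < cartan_int b a).
Proof. by move=> ha hb; rewrite !zc_sgn // dotC. Qed.

Lemma zc_abs_le3 a b : a \in Phi -> b \in Phi -> b != a -> b != - a ->
  -3 <= cartan_int a b <= 3.
Proof.
move=> ha hb h1 h2; have := zc_mul_lt4 ha hb h1 h2.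
have := zc_neg_sym ha hb; have := zc_pos_sym ha hb.
move: (cartan_int a b) (cartan_int b a) => x y.
case: (ltrgtP x 0) => [x0 _ /esym y0|x0 /esym y0 _|->]; last by lia.
- by nia.
- by nia.
Qed.

Lemma root_sub a b : a \in Phi -> b \in Phi -> 0 < dot a b -> a != b ->
  a - b \in Phi.
Proof.
move=> ha hb ab neq.
have neq2 : b != - a.
  apply: contraTneq ab => ->; rewrite dotNr oppr_gt0 -leNgt; exact: dot_ge0.
have x0 : 0 < cartan_int a b by rewrite zc_sgn.
have y0 : 0 < cartan_int b a by rewrite zc_sgn // dotC.
have lt4 := zc_mul_lt4 ha hb (negbT (contraNF (fun e => eqbLR (eq_sym _ _) e) neq)) neq2.
have [e|e] : cartan_int a b = 1 \/ cartan_int b a = 1 by nia.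
- by have := zc_refl hb ha; rewrite e scale1r.
- by have := root_opp (zc_refl ha hb); rewrite e scale1r opprB.
Qed.

Lemma root_add a b : a \in Phi -> b \in Phi -> dot a b < 0 -> a != - b ->
  a + b \in Phi.
Proof.
move=> ha hb ab neq; rewrite -[b]opprK; apply: root_sub => //.
  exact: root_opp.
by rewrite dotNr oppr_gt0.
Qed.

(** * Coordinates on the base, positive cone and height *)

Lemma al_root i : al i \in Phi.
Proof. by case: baseP => _ sub _; apply: sub; apply: mem_tnth. Qed.

Lemma cf_al i j : cf i (al j) = (i == j)%:R.
Proof.
case: baseP => /basis_free fr _ _.
by rewrite (tnth_nth 0) coord_free // eq_sym.
Qed.

Lemma cfE v : v = \sum_i cf i v *: al i.
Proof.
case: baseP => bs _ _; rewrite {1}(coord_basis bs (memvf v)).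
by apply: eq_bigr => i _; rewrite -tnth_nth.
Qed.

Lemma cf_inj u v : (forall i, cf i u = cf i v) -> u = v.
Proof. by move=> e; rewrite (cfE u) (cfE v); apply: eq_bigr => i _; rewrite e. Qed.

Definition npos v := [forall i, cf i v \is a Num.nat].

Lemma nposP v : reflect (forall i, cf i v \is a Num.nat) (npos v).
Proof. exact: forallP. Qed.

Lemma npos_ge0 v i : npos v -> 0 <= cf i v.
Proof. by move=> /nposP/(_ i)/natrP[m ->]; apply: ler0n. Qed.

Lemma npos0 : npos 0.
Proof. by apply/nposP => i; rewrite linear0 rpred0. Qed.

Lemma nposD u v : npos u -> npos v -> npos (u + v).
Proof. by move=> /nposP hu /nposP hv; apply/nposP => i; rewrite linearD rpredD ?hu ?hv. Qed.

Lemma npos_al i : npos (al i).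
Proof. by apply/nposP => j; rewrite cf_al; case: eqP; rewrite ?rpred0 ?rpred1. Qed.

Lemma npos_anti v : npos v -> npos (- v) -> v = 0.
Proof.
move=> hv hNv; apply: cf_inj => i; rewrite linear0; apply: le_anti.
have := npos_ge0 i hNv; rewrite linearN oppr_ge0 => ->.
exact: npos_ge0.
Qed.

Lemma in_pos a : (a \in pos_roots Phi Delta) = (a \in Phi) && npos a.
Proof.
rewrite !inE /=; case ha: (a \in Phi) => //=; apply/forallP/nposP => h i.
  case: baseP => _ _ /(_ _ ha)[//|/(_ i)/natrP[m e]].
  have := h i; rewrite -[cf i a]opprK e oppr_ge0 lern0 => /eqP ->.
  by rewrite oppr0 rpred0.
by have /natrP[m ->] := h i; apply: ler0n.
Qed.

Lemma root_sign a : a \in Phi -> npos a || npos (- a).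
Proof.
move=> ha; case: baseP => _ _ /(_ _ ha)[h|h]; apply/orP; [left|right].
  exact/nposP.
by apply/nposP => i; rewrite linearN h.
Qed.

Definition ht v : R := \sum_i cf i v.

Lemma htD u v : ht (u + v) = ht u + ht v.
Proof. by rewrite -big_split; apply: eq_bigr => i _; rewrite linearD. Qed.

Lemma ht0 : ht 0 = 0.
Proof. by rewrite /ht big1 // => i _; rewrite linear0. Qed.

Lemma htN v : ht (- v) = - ht v.
Proof. by apply/eqP; rewrite -addr_eq0 -htD addNr ht0. Qed.

Lemma ht_al i : ht (al i) = 1.
Proof.
rewrite /ht (bigD1 i) //= cf_al eqxx big1 ?addr0 // => j ji.
by rewrite cf_al (negPf ji).
Qed.

Lemma npos_htP v : npos v -> exists m : nat, ht v = m%:R.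
Proof.
by move=> /nposP hv; apply/natrP; apply: rpred_sum => i _.
Qed.

Lemma npos_ht_ge1 v : npos v -> v != 0 -> 1 <= ht v.
Proof.
move=> hv v0; have [m e] := npos_htP hv; rewrite e ler1n lt0n.
apply: contra v0 => /eqP m0; move: e; rewrite m0 => /eqP.
rewrite psumr_eq0 => [/allP h|i _]; last exact: npos_ge0.
apply/eqP/cf_inj => i; rewrite linear0; apply/eqP; exact: h (mem_index_enum _).
Qed.

(** Each simple root being positive, sums of positive roots and elements of the
    cone spanned by the simple roots are the same. *)
Lemma root_leP a b : root_le Phi Delta a b <-> npos (b - a).
Proof.
split=> [[s sub ->]|h].
  rewrite big_seq; apply: (big_ind npos); [exact: npos0 | exact: nposD |].
  by move=> x /sub; rewrite in_pos => /andP[].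
exists (flatten [seq nseq (Num.truncn (cf i (b - a))) (al i) | i <- enum 'I_n]).
  move=> x /flattenP[y /mapP[i _ ->]] /nseqP[-> _].
  by rewrite in_pos al_root npos_al.
rewrite big_flatten /= big_map big_enum /= {1}(cfE (b - a)).
apply: eq_bigr => i _; rewrite big_nseq iter_addr_0 -scaler_nat.
by have /nposP/(_ i)/natrP[m ->] := h; rewrite truncnK ?rpred_nat.
Qed.

Definition posr a := (a \in Phi) && npos a.

Lemma posr_root a : posr a -> a \in Phi. Proof. by case/andP. Qed.
Lemma posr_npos a : posr a -> npos a. Proof. by case/andP. Qed.
Lemma posr_nz a : posr a -> a != 0. Proof. by move/posr_root/root_nz. Qed.
Lemma posr_al i : posr (al i). Proof. by rewrite /posr al_root npos_al. Qed.
#[local] Hint Resolve posr_root posr_npos posr_nz al_root posr_al : core.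

Lemma posr_opp a : posr a -> ~~ npos (- a).
Proof.
move=> ha; apply: contra (posr_nz ha) => hN; apply/eqP; apply: npos_anti => //.
exact: posr_npos.
Qed.

(** * Simple reflections *)

Local Notation s k := (reflection (al k)).

Lemma cartanDl u v w : cartan (u + v) w = cartan u w + cartan v w.
Proof. by rewrite /cartan dotDl mulrDr mulrDl. Qed.

Lemma cartanZl c u v : cartan (c *: u) v = c * cartan u v.
Proof. by rewrite /cartan dotZl; ring. Qed.

Lemma cartanBl u v w : cartan (u - v) w = cartan u w - cartan v w.
Proof. by rewrite cartanDl -scaleN1r cartanZl mulN1r. Qed.

Lemma cartan_al k : cartan (al k) (al k) = 2.
Proof. by rewrite /cartan mulfK // lt0r_neq0 // root_dot_gt0. Qed.

Lemma reflK k v : s k (s k v) = v.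
Proof.
rewrite {1}/reflection /reflection cartanBl cartanZl cartan_al.
by rewrite -addrA -opprD -scalerDl [X in X *: _](_ : _ = 0) ?scale0r ?subr0 //; ring.
Qed.

Lemma dot_refl k u v : dot (s k u) (s k v) = dot u v.
Proof.
have c w : cartan w (al k) * dot (al k) (al k) = 2 * dot w (al k).
  by rewrite /cartan divfK // lt0r_neq0 // root_dot_gt0.
rewrite /reflection !(dotDl, dotDr, dotNl, dotNr, dotZl, dotZr) (dotC (al k) v).
have := congr1 (fun z => cartan u (al k) * z) (c v).
have := congr1 (fun z => cartan v (al k) * z) (c u).
by lra.
Qed.

Lemma dot_refl_sym k u v : dot (s k u) v = dot u (s k v).
Proof. by rewrite -{1}(reflK k v) dot_refl. Qed.

Lemma cf_refl i k v : i != k -> cf i (s k v) = cf i v.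
Proof. by move=> ik; rewrite linearB linearZ /= cf_al (negPf ik) mulr0 subr0. Qed.

Lemma refl_root k a : a \in Phi -> s k a \in Phi.
Proof. by move=> ha; apply: (root_reflection rsP). Qed.

(** A simple reflection changes a single coordinate, so a positive root other
    than the corresponding simple root keeps a positive coordinate. *)
Lemma refl_pos k a : posr a -> a != al k -> posr (s k a).
Proof.
move=> ha neq; have ha' := posr_root ha; rewrite /posr refl_root //=.
case/orP: (root_sign (refl_root k ha')) => // hN.
have z i : i != k -> cf i a = 0.
  move=> ik; apply: le_anti; rewrite npos_ge0 ?posr_npos // andbT.
  by rewrite -(cf_refl _ ik) -oppr_ge0 -linearN npos_ge0.
have e : a = cf k a *: al k.
  rewrite {1}(cfE a) (bigD1 k) //= big1 ?addr0 // => i ik.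
  by rewrite z // scale0r.
case: (root_prop (al_root k) ha' e) => e2; first by rewrite e2 eqxx in neq.
by have := posr_opp (posr_al k); rewrite -e2 posr_npos.
Qed.

Lemma al_neq i j : i != j -> al i != al j.
Proof.
by apply: contra => /eqP/(congr1 (cf i)); rewrite !cf_al eqxx;
  case: eqP => // _ /eqP; rewrite oner_eq0.
Qed.

Lemma al_neqN i j : al i != - al j.
Proof.
apply/eqP => e; have := posr_opp (posr_al j); by rewrite -e npos_al.
Qed.

Lemma al_dot_le0 i j : i != j -> dot (al i) (al j) <= 0.
Proof.
move=> ij; rewrite leNgt; apply/negP => h.
have /root_sign/orP[/(npos_ge0 j)|/(npos_ge0 i)] := root_sub (al_root i) (al_root j) h (al_neq ij).
  by rewrite linearB /= !cf_al eqxx eq_sym (negPf ij) sub0r oppr_ge0 ler10.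
by rewrite linearN linearB /= !cf_al eqxx (negPf ij) subr0 oppr_ge0 ler10.
Qed.

Lemma npos_dot_gt0 v u : npos v -> 0 < dot u v ->
  exists k, (0 < cf k v) && (0 < dot u (al k)).
Proof.
move=> hv; rewrite {1}(cfE v) dot_sumr => h; apply/existsP.
apply: contraLR h => /existsPn h; rewrite -leNgt; apply: sumr_le0 => k _.
rewrite dotZr; have := h k; rewrite negb_and -!leNgt => /orP[h0|h0].
  by rewrite (_ : cf k v = 0) ?mul0r //; apply: le_anti; rewrite h0 npos_ge0.
by rewrite mulr_ge0_le0 // npos_ge0.
Qed.

Lemma npos_sub_al v k : npos v -> 0 < cf k v -> npos (v - al k).
Proof.
move=> /nposP hv h; apply/nposP => i; rewrite linearB /= cf_al.
have /natrP[m e] := hv i; case: eqP => [ik|_]; last by rewrite subr0 e rpred_nat.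
move: h; rewrite -ik e ltr0n => m0.
by rewrite -(natrB _ m0) rpred_nat.
Qed.

(** Every positive root is reached from the simple roots by simple
    reflections: a positive root has positive inner product with some simple
    root, and reflecting in that simple root lowers the height. *)
Lemma posr_ind (P : V -> Prop) :
    (forall i, P (al i)) ->
    (forall a k, posr a -> P a -> posr (s k a) -> P (s k a)) ->
  forall a, posr a -> P a.
Proof.
move=> wpos PS a ha; have [m] := npos_htP (posr_npos ha).
elim/ltn_ind: m a ha => m IH a ha e.
have [k /andP[_ h]] := npos_dot_gt0 (posr_npos ha) (root_dot_gt0 (posr_root ha)).
have [->//|neq] := eqVneq a (al k).
have hb := refl_pos ha neq.
have [m' e'] := npos_htP (posr_npos hb).
rewrite -(reflK k a); apply: (PS) => //; last by rewrite reflK.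
apply: (IH m') => //; rewrite -(ltr_nat R) -e -e'.
rewrite /reflection htD htN -(zcE (posr_root ha) (al_root k)).
have -> c : ht (c *: al k) = c.
  rewrite /ht (eq_bigr (fun i => c * cf i (al k))) => [|i _]; last first.
    by rewrite linearZ.
  by rewrite -mulr_sumr -/(ht _) ht_al mulr1.
by rewrite gtrBl ltr0z zc_sgn // posr_root.
Qed.

(** If a <= b are positive roots, then b is reached from a by successively
    adding simple roots, with all the intermediate sums roots: as |b - a|^2 > 0,
    some simple root in the support of b - a can be subtracted from b or
    added to a. *)
Lemma chain_ind (P : V -> Prop) :
    (forall g k, posr g -> posr (g + al k) -> P g -> P (g + al k)) ->
  forall a b, posr a -> posr b -> npos (b - a) -> P a -> P b.
Proof.
move=> PS a b ha hb hab; have [m] := npos_htP hab.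
elim: m a b ha hb hab => [|m IH] a b ha hb hab e Pa.
  have [/eqP|v0] := eqVneq (b - a) 0; first by rewrite subr_eq0 => /eqP ->.
  by have := npos_ht_ge1 hab v0; rewrite e ler10.
have v0 : b - a != 0.
  by apply: contra_eq_neq e => ->; rewrite ht0 eq_sym pnatr_eq0.
have v1 : 0 < dot (b - a) (b - a) by rewrite dot_gt0.
have [k /andP[ck]] := npos_dot_gt0 hab v1.
have hv := npos_sub_al hab ck.
have hs : npos (b - al k).
  by rewrite -(subrK a b) -addrA [a - _]addrC addrA nposD // posr_npos.
rewrite dotDl dotNl; have [h _|h h2] := ltrP 0 (dot b (al k)).
  have neq : b != al k.
    apply: contraTneq (ha) => eb; apply/negP => ha2.
    have h3 : npos (- a) by move: hv; rewrite eb addrAC subrr sub0r.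
    by have := posr_opp ha; rewrite h3.
  have hc : posr (b - al k) by rewrite /posr root_sub // posr_root.
  rewrite -(subrK (al k) b); apply: PS => //; first by rewrite subrK.
  apply: (IH a) => //; first by rewrite addrAC.
  by rewrite addrAC htD htN e ht_al -addn1 natrD addrK.
have h3 : dot a (al k) < 0 by rewrite ltNge; apply/negP; lra.
have neq : a != - al k.
  apply: contraTneq (ha) => ->; apply/negP => /posr_npos.
  by apply/negP/posr_opp.
have hc : posr (a + al k) by rewrite /posr root_add ?nposD ?posr_npos ?posr_root.
apply: (IH (a + al k)) => //; first by rewrite opprD addrA.
  by rewrite opprD addrA htD htN e ht_al -addn1 natrD addrK.
exact: PS.
Qed.

(** Simple reflections are isometries and generate all the roots from the
    simple ones. *)
Lemma root_length a : a \in Phi -> exists i, dot a a = dot (al i) (al i).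
Proof.
have H b : posr b -> exists i, dot b b = dot (al i) (al i).
  move: b; apply: posr_ind => [i|b k _ [i e] _]; first by exists i.
  by exists i; rewrite dot_refl.
move=> ha; case/orP: (root_sign ha) => hp; first by apply: H; rewrite /posr ha.
have [|i e] := H (- a); first by rewrite /posr root_opp.
by exists i; rewrite -e dotNl dotNr opprK.
Qed.

(** Simple reflections act on the coroot lattice by unimodular
    transformations, so that the coordinates c of a coroot on the simple
    coroots stay integral and keep a Bezout relation, with coefficients b. The
    latter says that a coroot is not divisible by any prime in the lattice. *)
Lemma coroot_coord a : posr a -> exists c b : 'I_n -> int,
  (forall v, cartan v a = \sum_i (c i)%:~R * cartan v (al i)) /\
  \sum_i b i * c i = 1.
Proof.
move: a; apply: posr_ind => [k|a k ha [c [b [hc hb]]] _].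
  exists (fun i => (i == k)%:R), (fun i => (i == k)%:R); split=> [v|].
    rewrite (bigD1 k) //= eqxx big1 ?addr0 ?mul1r // => i ik.
    by rewrite (negPf ik) mul0r.
  by rewrite (bigD1 k) //= eqxx big1 ?addr0 ?mul1r // => i ik; rewrite (negPf ik) mul0r.
pose m i := cartan_int (al k) (al i); pose M := \sum_i c i * m i.
exists (fun i => c i - (i == k)%:R * M), (fun i => b i - b k * m i); split=> [v|].
  have -> : cartan v (s k a) = cartan (s k v) a.
    by rewrite /cartan dot_refl dot_refl_sym.
  rewrite hc.
  have -> : \sum_i (c i - (i == k)%:R * M)%:~R * cartan v (al i) =
    \sum_i (c i)%:~R * cartan v (al i) - M%:~R * cartan v (al k).
    rewrite (bigD1 k) //= (bigD1 k (P := predT)) //= eqxx mul1r rmorphB /=.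
    rewrite (eq_bigr (fun i => (c i)%:~R * cartan v (al i))).
      by ring.
    by move=> i ik; rewrite (negPf ik) mul0r subr0.
  rewrite /M rmorph_sum mulr_suml -sumrB; apply: eq_bigr => i _.
  rewrite {1}/reflection cartanBl cartanZl rmorphM /= zcE //.
  by ring.
have bM : \sum_i m i * c i = M by apply: eq_bigr => i _; rewrite mulrC.
have k1 (f : 'I_n -> int) : \sum_i f i * ((i == k)%:R * M) = f k * M.
  rewrite (bigD1 k) //= eqxx mul1r big1 ?addr0 // => i ik.
  by rewrite (negPf ik) mul0r mulr0.
under eq_bigr => i _ do rewrite mulrBl !mulrBr -mulrA.
rewrite !sumrB hb k1 -mulr_sumr bM.
rewrite (eq_bigr (fun i => b k * (m i * ((i == k)%:R * M)))); last first.
  by move=> i _; rewrite mulrA.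
by rewrite -mulr_sumr k1 {1}/m zcaa //; ring.
Qed.

(** * Irreducibility *)

Hypothesis irr : irreducible_roots Phi.

(** If S is orthogonal to its complement, each root is supported on one of the
    two, since a simple reflection in one side fixes the span of the other;
    this splits Phi into orthogonal parts. *)
Lemma simple_roots_connected (S : pred 'I_n) :
  (forall i j, S i -> ~~ S j -> dot (al i) (al j) = 0) ->
  (exists i, S i) -> forall j, S j.
Proof.
move=> orth [i0 Si0].
pose inS a := [forall i, S i || (cf i a == 0)].
pose offS a := [forall i, S i ==> (cf i a == 0)].
have orthS a b : inS a -> offS b -> dot a b = 0.
  move=> /forallP ha /forallP hb; rewrite (cfE a) dot_suml big1 // => i _.
  rewrite dotZl; have /orP[Si|/eqP ->] := ha i; last by rewrite mul0r.
  rewrite (cfE b) dot_sumr big1 ?mulr0 // => j _.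
  rewrite dotZr; have [Sj|Sj] := boolP (S j); last by rewrite orth ?mulr0.
  by have := hb j; rewrite Sj /= => /eqP ->; rewrite mul0r.
have inS_al i : S i -> inS (al i).
  by move=> Si; apply/forallP => j; rewrite cf_al;
  case: (eqVneq j i) => [->|_]; rewrite ?Si ?eqxx ?orbT.
have offS_al i : ~~ S i -> offS (al i).
  move=> Si; apply/forallP => j; apply/implyP => Sj; rewrite cf_al.
  by case: (eqVneq j i) => [e|_]; [rewrite e (negPf Si) in Sj | rewrite eqxx].
have dich a : posr a -> inS a || offS a.
  move: a; apply: posr_ind => [i|a k _ IH _].
    by have [/inS_al ->|/offS_al ->] := boolP (S i); rewrite ?orbT.
  have fix_k : dot a (al k) = 0 -> s k a = a.
    by rewrite /reflection /cartan => ->; rewrite mulr0 mul0r scale0r subr0.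
  have [Sk|Sk] := boolP (S k); case/orP: IH => h.
  - apply/orP; left; apply/forallP => i; have [Si|Si] //= := boolP (S i).
    rewrite cf_refl; first by have /forallP/(_ i) := h; rewrite (negPf Si).
    by apply: contraNneq Si => ->.
  - by rewrite fix_k ?h ?orbT // dotC orthS // inS_al.
  - by rewrite fix_k ?h // orthS // offS_al.
  - apply/orP; right; apply/forallP => i; apply/implyP => Si.
    rewrite cf_refl; first by have /forallP/(_ i) := h; rewrite Si.
    by apply: contraNneq Sk => <-.
have inSN a : inS (- a) = inS a by apply: eq_forallb => i; rewrite linearN oppr_eq0.
have offSN a : offS (- a) = offS a by apply: eq_forallb => i; rewrite linearN oppr_eq0.
have dichR a : a \in Phi -> inS a || offS a.
  move=> ha; case/orP: (root_sign ha) => hp; first by apply: dich; rewrite /posr ha.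
  by rewrite -inSN -offSN; apply: dich; rewrite /posr root_opp.
pose A := [fset a in Phi | inS a].
have [_ /(_ A)] := irr; case.
- by apply/fsubsetP => a; rewrite !inE /= => /andP[].
- move=> a b; rewrite !inE /= => /andP[_ ha] /andP[]; case: (boolP (b \in Phi)) => //= hb hb2 _.
  by apply: orthS => //; case/orP: (dichR b hb) => // h; rewrite h in hb2.
- by move=> /fsetP/(_ (al i0)); rewrite !inE /= al_root inS_al.
- move=> /fsetP e j; have := e (al j); rewrite !inE /= al_root /=.
  by move/forallP/(_ j); rewrite cf_al eqxx oner_eq0 orbF.
Qed.

End Roots.
(** * Dynkin diagrams with a multiple edge *)

(** The matrix m is a Cartan matrix: m i j = <alpha_i, alpha_j^vee>. The
    positivity of the inner product is used in the form of the hypothesis mpos: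
    a nonzero nonnegative combination v of simple roots has positive inner
    product with some alpha_i of its support, as otherwise |v|^2 <= 0. A
    diagram is excluded by exhibiting a v for which this fails; the coefficients
    of v are those of the null root of an affine diagram. *)
Section Dynkin.
Variables (n : nat) (m : 'I_n -> 'I_n -> int).
Hypotheses (mii : forall i, m i i = 2)
  (mle0 : forall i j, i != j -> m i j <= 0)
  (msym : forall i j, (m i j < 0) = (m j i < 0))
  (mlt4 : forall i j, i != j -> m i j * m j i < 4)
  (mconn : forall S : pred 'I_n,
     (forall i j, S i -> ~~ S j -> m i j = 0) ->
     (exists i, S i) -> forall j, S j).
Implicit Types (l : seq ('I_n * int)) (r : seq 'I_n).

(** The integer <v, alpha_i^vee>, where v is the combination of simple roots
    given by the weighted nodes of l. *)
Definition pairing l i := \sum_(q <- l) q.2 * m q.1 i.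

Definition weighted l := uniq [seq q.1 | q <- l] && all (fun q => 0 < q.2) l.

Hypothesis mpos : forall l, l != [::] -> weighted l ->
  exists2 p, p \in l & 0 < pairing l p.1.

Lemma test_false l : l != [::] -> weighted l ->
  (forall p, p \in l -> pairing l p.1 <= 0) -> False.
Proof. by move=> l0 wl h; have [p /h] := mpos l0 wl; rewrite leNgt => /negP. Qed.

Lemma pairing_cons p l i : pairing (p :: l) i = p.2 * m p.1 i + pairing l i.
Proof. by rewrite /pairing big_cons. Qed.

Lemma pairing0 i : pairing [::] i = 0.
Proof. by rewrite /pairing big_nil. Qed.

Lemma pairing_le0 l i : all (fun q => 0 < q.2) l ->
  i \notin [seq q.1 | q <- l] -> pairing l i <= 0.
Proof.
elim: l => [|p l IH] /=; first by rewrite pairing0.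
move=> /andP[p0 hl]; rewrite inE negb_or => /andP[ip hi].
have := IH hl hi; have := @mle0 p.1 i; rewrite eq_sym => /(_ ip).
by rewrite pairing_cons; nia.
Qed.

Lemma adj_le i j : i != j -> m i j != 0 -> (m i j <= -1) /\ (m j i <= -1).
Proof. by move=> ij h; have := mle0 ij; have := msym i j; lia. Qed.

(** * Growing a simple chain from a multiple edge *)

(** The weighted nodes of a chain with head h have nonpositive pairing with
    each of them but the head, where the pairing is at most 2. Whatever could
    be attached to the head so as to compensate for this 2 is excluded. *)
Definition chain_inv l h :=
  [/\ weighted l, (h, 2) \in l, pairing l h <= 2 &
      forall q, q \in [seq p.1 | p <- l] -> q != h -> pairing l q <= 0].

Lemma chain_out l h t : chain_inv l h -> t \notin [seq p.1 | p <- l] ->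
  pairing l t <= 2 * m h t.
Proof.
move=> [/andP[_ hl] hin _ _] tl.
have e := perm_big _ (perm_to_rem hin) : pairing l t = _; rewrite e big_cons /=.
rewrite gerDl; apply: (@pairing_le0 (rem (h, 2) l)).
  by apply/allP => x /mem_rem/(allP hl).
by apply: contra tl => /mapP[x /mem_rem xl ->]; apply: map_f.
Qed.

Lemma chain_head l h : chain_inv l h -> h \in [seq p.1 | p <- l].
Proof. by case=> _ hin _ _; apply: (map_f fst hin). Qed.

Lemma chain_notin l h t : chain_inv l h -> t \notin [seq p.1 | p <- l] -> t != h.
Proof. by move=> /chain_head hin; apply: contraNneq => ->. Qed.

(** Adding a neighbour of the head, with weight 2, cancels the excess there and
    makes the new node the head. *)
Lemma chain_step l h t : chain_inv l h -> t \notin [seq p.1 | p <- l] ->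
  m h t != 0 -> chain_inv ((t, 2) :: l) t.
Proof.
move=> inv tl adj; have th := chain_notin inv tl; have out := chain_out inv tl.
have [|a1 a2] := adj_le _ adj; first by rewrite eq_sym.
case: inv => /andP[ul hl] hin hh hq; split.
- by rewrite /weighted /= tl ul.
- by rewrite inE eqxx.
- by rewrite pairing_cons /= mii; lra.
- move=> q; rewrite inE /= => /orP[->//|ql] qt.
  have := @mle0 t q; rewrite eq_sym => /(_ qt); rewrite pairing_cons /=.
  have [->|qh] := eqVneq q h; first by lra.
  by have := hq q ql qh; lra.
Qed.

(** Two more neighbours of the head, with weight 1, compensate for the 2. *)
Lemma chain_nofork l h t t' : chain_inv l h ->
  t \notin [seq p.1 | p <- l] -> t' \notin [seq p.1 | p <- l] -> t != t' ->
  m h t != 0 -> m h t' != 0 -> False.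
Proof.
move=> inv tl tl' tt adj adj'.
have out := chain_out inv tl; have out' := chain_out inv tl'.
have th := chain_notin inv tl; have th' := chain_notin inv tl'.
have [|a1 a2] := adj_le _ adj; first by rewrite eq_sym.
have [|a1' a2'] := adj_le _ adj'; first by rewrite eq_sym.
have mt := mle0 tt; have mt' : m t' t <= 0 by rewrite mle0 // eq_sym.
case: inv => /andP[ul hl] hin hh hq.
apply: (@test_false ((t, 1) :: (t', 1) :: l)) => //.
  by rewrite /weighted /= ul hl inE (negPf tt) (negPf tl) (negPf tl').
move=> p; rewrite !inE => /or3P[/eqP ->|/eqP ->|pl]; rewrite !pairing_cons /=.
- by rewrite mii; lra.
- by rewrite mii; lra.
- have pl' := map_f fst pl.
  have tp : t != p.1 by apply: contraNneq tl => ->.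
  have tp' : t' != p.1 by apply: contraNneq tl' => ->.
  have mtp := mle0 tp; have mtp' := mle0 tp'.
  have [->|qh] := eqVneq p.1 h; first by lra.
  by have := hq _ pl' qh; lra.
Qed.

(** So does one neighbour joined by a multiple edge, with weight 1 or 2
    according to the direction of the edge. *)
Lemma chain_nomulti l h t : chain_inv l h -> t \notin [seq p.1 | p <- l] ->
  2 <= m h t * m t h -> False.
Proof.
move=> inv tl ge2.
have out := chain_out inv tl; have th := chain_notin inv tl.
have hth : h != t by rewrite eq_sym.
have mt := mle0 th; have mt' := mle0 hth.
case: inv => /andP[ul hl] hin hh hq.
have mq q : q \in [seq p.1 | p <- l] -> m t q <= 0.
  by move=> ql; apply: mle0; apply: contraNneq tl => ->.
have H (y : int) : 0 < y -> y * m t h <= -2 -> 2 * y + 2 * m h t <= 0 -> False.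
  move=> y0 y1 y2; apply: (@test_false ((t, y) :: l)) => //.
    by rewrite /weighted /= ul hl tl y0.
  move=> p; rewrite inE => /orP[/eqP ->|pl]; rewrite !pairing_cons /=.
    by rewrite mii; lra.
  have [->|qh] := eqVneq p.1 h; first by lra.
  have pl' := map_f fst pl; have := mulr_ge0_le0 (ltW y0) (mq _ pl').
  by have := hq _ pl' qh; lra.
move: mt mt' ge2 H {hh out}; set x := m t h; set z := m h t => mt mt' ge2 H.
have [le|gt] := lerP x (-2); first by apply: (H 1); clear -mt mt' ge2 le; lia.
by apply: (H 2); clear -mt mt' ge2 gt; nia.
Qed.

(** The head is the end at which the chain grows; the last two nodes are joined
    by the multiple edge, and nothing is required of them. *)
Fixpoint simple_chain r : bool :=
  if r is h :: r' then
    if r' is h' :: (_ :: _) as r'' then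
      [&& m h h' == -1, m h' h == -1,
          all (fun q => (m h q == 0) && (m q h == 0)) (behead r') &
          simple_chain r']
    else true
  else true.

(** The multiple edge at the end c0 is a chain with head c1 in the above sense,
    if c1 has weight 2 and c0 weight 1 or 2 according to the direction of the
    edge. Only its head can have further neighbours, and these extend it by a
    simple edge; by connectedness it grows until it contains all nodes. *)
Lemma end_chain c0 c1 : c0 != c1 -> 2 <= m c0 c1 * m c1 c0 ->
  (forall j, j != c0 -> j != c1 -> m c0 j = 0) ->
  exists r, [/\ size r = n, uniq r, simple_chain r &
    exists r', r = r' ++ [:: c1; c0]].
Proof.
move=> c01 ge2 only.
have c10 : c1 != c0 by rewrite eq_sym.
have l01 := mle0 c01; have l10 := mle0 c10.
have [x0 [x0_gt0 x1 x2]] : exists x0 : int,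
    [/\ 0 < x0, x0 * m c0 c1 <= -2 & 2 * x0 + 2 * m c1 c0 <= 0].
  by have [h|h] := lerP (m c0 c1) (-2); [exists 1|exists 2]; split=> //; nia.
have nge : (2 <= n)%N.
  have : nat_of_ord c0 <> c1 by move/val_inj => e; rewrite e eqxx in c01.
  by have := ltn_ord c0; have := ltn_ord c1; lia.
suff H k : (k.+2 <= n)%N -> exists r h l, [/\ size r = k.+2, head h r = h,
    chain_inv l h & [seq p.1 | p <- l] = r] /\
    [/\ simple_chain r,
      forall i j, i \in r -> i != h -> j \notin r -> m i j = 0 &
      exists r', r = r' ++ [:: c1; c0]].
  have [r [h [l [[sr _ inv el] [sc _ er]]]]] := H n.-2 ltac:(lia).
  exists r; split=> //; first by rewrite sr; lia.
  by case: inv => /andP[]; rewrite el.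
elim: k => [_|k IH kn].
  exists [:: c1; c0], c1, [:: (c1, 2); (c0, x0)]; split; split=> //.
  - split.
    + by rewrite /weighted /= inE c10 x0_gt0.
    + by rewrite inE eqxx.
    + by rewrite !pairing_cons pairing0 /= mii; lia.
    + move=> q; rewrite !inE => /orP[/eqP ->|/eqP -> _]; first by rewrite eqxx.
      by rewrite !pairing_cons pairing0 /= mii; lia.
  - move=> i j; rewrite !inE => /orP[/eqP ->|/eqP -> _]; first by rewrite eqxx.
    by rewrite negb_or => /andP[j1 j0]; apply: only.
  - by exists [::].
have [r [h [l [[sr hr inv el] [sc out [r' er]]]]]] := IH (ltnW kn).
have hin : h \in r by rewrite -el chain_head.
have ur : uniq r by rewrite -el; case: inv => /andP[].
have [t tr adj] : exists2 t, t \notin r & m h t != 0.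
  have [/existsP[t /andP[]]|/existsPn none] :=
    boolP [exists t, (t \notin r) && (m h t != 0)]; first by exists t.
  have all_r : forall j, j \in r.
    apply: (mconn (S := mem r)) => [i j /= ir jr|]; last by exists h.
    have [ih|/out] := eqVneq i h; last exact.
    by have := none j; rewrite jr /= negbK ih => /eqP.
  have : (size (enum 'I_n) <= size r)%N by apply: uniq_leq_size; rewrite ?enum_uniq.
  by rewrite -cardE card_ord sr; lia.
have tl : t \notin [seq p.1 | p <- l] by rewrite el.
have inv' := chain_step inv tl adj.
have [|a1 a2] := adj_le _ adj; first by rewrite eq_sym (chain_notin inv tl).
have nm : m h t * m t h < 2.
  by rewrite ltNge; apply/negP; exact: (chain_nomulti inv tl).
exists (t :: r), t, ((t, 2) :: l); split; split=> //=; first by rewrite sr.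
- by rewrite el.
- case: r sr hr sc out {er} el hin ur tr => [//|h' r1] /= sr hr sc out el hin ur tr.
  rewrite -hr in adj a1 a2 nm out.
  case: r1 sr sc out el hin ur tr => [//|h2 r2] sr sc out el hin ur tr.
  apply/and4P; split; [clear -a1 a2 nm; by nia | clear -a1 a2 nm; by nia | | exact: sc].
  apply/allP => q qr; have qh : q != h'.
    by apply: contraNneq (andP ur).1 => <-.
  have := out q t; rewrite inE [q \in _]qr orbT qh tr => /(_ isT isT isT) e.
  have tq : t != q by apply: contraNneq tr => ->; rewrite inE [q \in _]qr orbT.
  rewrite e eqxx andbT eq_le mle0 //.
  by rewrite leNgt msym e ltxx.
- move=> i j; rewrite !inE negb_or => /orP[->//|ir] it /andP[jt jr].
  have [ih|ih] := eqVneq i h; last exact: out.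
  apply/eqP/negPn/negP => adj'; rewrite ih in adj'.
  by apply: (chain_nofork inv tl _ _ adj adj'); rewrite ?el // eq_sym.
- by exists (t :: r'); rewrite er.
Qed.

Lemma simple_chain_nth r x0 i j : simple_chain r -> (i < j < size r)%N ->
  ((i.+1 < j)%N -> m (nth x0 r i) (nth x0 r j) = 0 /\
                  m (nth x0 r j) (nth x0 r i) = 0) /\
  (i.+1 = j -> (j.+1 < size r)%N -> m (nth x0 r i) (nth x0 r j) = -1 /\
                  m (nth x0 r j) (nth x0 r i) = -1).
Proof.
elim: r i j => [|h [|h' [|h2 r]] IH] i j.
- by move=> _ /= hij; exfalso; lia.
- by move=> _ /= hij; exfalso; lia.
- by move=> _ /= hij; split=> *; exfalso; lia.
move=> /and4P[/eqP e1 /eqP e2 /allP z sc].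
case: j => [|j]; first by lia.
case: i => [|i] ij; last first.
  have [|h1 h3] := IH i j sc; first by move: ij => /=; lia.
  by split=> hj; [apply: h1; lia | move=> lt; apply: h3; move: lt => /=; lia].
split=> [hj|]; last by case=> <-.
case: j hj ij => [|j] hj ij; first by lia.
have /z /andP[/eqP -> /eqP ->] // : nth x0 (h2 :: r) j \in h2 :: r.
by apply: mem_nth; move: ij => /=; lia.
Qed.

Lemma perm_of_list r (x0 : 'I_n) : size r = n -> uniq r ->
  exists s : 'S_n, forall i, s i = nth x0 r i.
Proof.
move=> sr ur; have inj : injective (fun i : 'I_n => nth x0 r i).
  by move=> i j /eqP; rewrite nth_uniq ?sr // => /eqP/val_inj.
by exists (perm inj) => i; rewrite permE.
Qed.

Lemma end_chain_cartan c0 c1 : c0 != c1 -> 2 <= m c0 c1 * m c1 c0 ->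
  (forall j, j != c0 -> j != c1 -> m c0 j = 0) ->
  (2 <= n)%N /\ exists s : 'S_n, forall i j : 'I_n, m (s i) (s j) =
    if i == j :> nat then 2
    else if (j == i.+1 :> nat) then (if j == n.-1 :> nat then m c1 c0 else -1)
    else if (i == j.+1 :> nat) then (if i == n.-1 :> nat then m c0 c1 else -1)
    else 0.
Proof.
move=> c01 ge2 only; have [r [sr ur sc [r' er]]] := end_chain c01 ge2 only.
have sr' : (size r').+2 = n by move: sr; rewrite er size_cat /= addn2.
split; first by lia.
have [s hs] := perm_of_list c0 sr ur; exists s => i j; rewrite !hs.
have e1 : n.-1 = (size r').+1 by lia.
have e2 : n.-2 = size r' by lia.
have n0 : nth c0 r n.-1 = c0 by rewrite e1 er nth_cat ltnNge leqW //= subSnn.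
have n1 : nth c0 r n.-2 = c1 by rewrite e2 er nth_cat ltnn subnn.
have hi := ltn_ord i; have hj := ltn_ord j.
have key (a b : nat) := @simple_chain_nth r c0 a b sc.
rewrite sr in key.
case: (ltngtP i j) => [ij|ij|->]; last by rewrite mii.
- have [z o] := key i j ltac:(lia).
  case: (eqVneq (j : nat) i.+1) => [e|ne]; last first.
    by rewrite (_ : (i == j.+1 :> nat) = false); [case: z => //; lia | lia].
  case: (eqVneq (j : nat) n.-1) => [en|nen]; last by case: o => //; lia.
  by rewrite en n0 (_ : nat_of_ord i = n.-2) ?n1 //; lia.
- have [z o] := key j i ltac:(lia).
  rewrite (_ : (j == i.+1 :> nat) = false); last by lia.
  case: (eqVneq (i : nat) j.+1) => [e|ne]; last by case: z => //; lia.
  case: (eqVneq (i : nat) n.-1) => [en|nen]; last by case: o => //; lia.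
  by rewrite en n0 (_ : nat_of_ord j = n.-2) ?n1 //; lia.
Qed.

Ltac all_mle0 := repeat match goal with
  | H : is_true (negb (eq_op ?x ?y)) |- _ =>
    let A := fresh "A" in let B := fresh "B" in
    have A := mle0 H;
    (have B : m y x <= 0 by apply: mle0; rewrite eq_sym); clear H
  end.

(* The pairing of a weighted list of nodes with each of its nodes is bounded
   using the known bounds on the edges, and 0 for the others. *)
Ltac exclude l :=
  apply: (@test_false l); [by [] | rewrite /weighted /= !inE ?negb_or;
    repeat (apply/andP; split); by [done | rewrite eq_sym] |];
  all_mle0; let p := fresh "p" in let hp := fresh "hp" in
  move=> p; rewrite !inE => hp; repeat (case/orP: hp => hp); move/eqP: hp => ->;
  rewrite !pairing_cons pairing0 /= !mii; lra.

(** A third node, attached to either end of a triple edge, is excluded by the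
    affine diagrams extending G_2. *)
Lemma triple_edge a b : m a b = -3 -> n = 2%N /\ exists s : 'S_n, forall i j : 'I_n,
  m (s i) (s j) = chain_cartan 1 0 (-3) i j.
Proof.
move=> mab; have ab : a != b by apply: contra_eq_neq mab => ->; rewrite mii.
have mba : m b a = -1.
  by have := mlt4 ab; have := msym a b; rewrite mab; lia.
have all2 : forall j, j \in [:: b; a].
  apply: (mconn (S := mem [:: b; a])) => [i j /= hi hj|]; last first.
    by exists a; rewrite /= !inE eqxx orbT.
  move: hj; rewrite !inE negb_or => /andP[jb ja].
  apply/eqP/negPn/negP => adj; move: hi; rewrite !inE => /orP[]/eqP ei; subst i.
    have [|a1 a2] := adj_le _ adj; first by rewrite eq_sym.
    exclude [:: (b, 2 : int); (a, 1); (j, 1)].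
  have [|a1 a2] := adj_le _ adj; first by rewrite eq_sym.
  exclude [:: (b, 3 : int); (a, 2); (j, 1)].
have ur : uniq [:: b; a] by rewrite /= inE eq_sym ab.
have n2 : n = 2%N.
  have e : [:: b; a] =i enum 'I_n by move=> j; rewrite all2 mem_enum.
  by have := uniq_size_uniq ur e; rewrite enum_uniq -cardE card_ord => /esym/eqP.
split=> //; have [|s hs] := @perm_of_list [:: b; a] a _ ur; first exact: esym n2.
exists s => i j; rewrite !hs.
by case: i j => [[|[|i]] hi] [[|[|j]] hj] /=; (try by exfalso; lia);
  rewrite ?mii ?mba ?mab.
Qed.

(** If a or b has no other neighbour, the diagram is a chain ending with the
    double edge. Otherwise a neighbour l of a and a neighbour t of b form with
    them a diagram F_4, and no fifth node can be attached to it. *)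
Lemma double_edge a b : m a b = -2 ->
  ((2 <= n)%N /\ exists s : 'S_n, forall i j : 'I_n,
     m (s i) (s j) = chain_cartan n.-2 n.-1 (-2) i j) \/
  ((2 <= n)%N /\ exists s : 'S_n, forall i j : 'I_n,
     m (s i) (s j) = chain_cartan n.-1 n.-2 (-2) i j) \/
  (n = 4%N /\ exists s : 'S_n, forall i j : 'I_n,
     m (s i) (s j) = chain_cartan 1 2 (-2) i j).
Proof.
move=> mab; have ab : a != b by apply: contra_eq_neq mab => ->; rewrite mii.
have ba : b != a by rewrite eq_sym.
have mba : m b a = -1.
  by have := mlt4 ab; have := msym a b; rewrite mab; lia.
have [/existsP[t /and3P[tb ta adjt]]|/existsPn onlyb] :=
  boolP [exists t, [&& t != b, t != a & m b t != 0]]; last first.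
  left; have [||n2 [s hs]] := end_chain_cartan ba; first by rewrite mab mba.
    by move=> j jb ja; have := onlyb j; rewrite jb ja /= negbK => /eqP.
  split=> //; exists s => i j; rewrite hs mab mba /chain_cartan.
  have := ltn_ord i; have := ltn_ord j.
  by repeat (case: ifP => ?); rewrite //=; lia.
have [/existsP[l /and3P[lb la adjl]]|/existsPn onlya] :=
  boolP [exists l, [&& l != b, l != a & m a l != 0]]; last first.
  right; left; have [||n2 [s hs]] := end_chain_cartan ab; first by rewrite mab mba.
    by move=> j ja jb; have := onlya j; rewrite jb ja /= negbK => /eqP.
  split=> //; exists s => i j; rewrite hs mab mba /chain_cartan.
  have := ltn_ord i; have := ltn_ord j.
  by repeat (case: ifP => ?); rewrite //=; lia.
right; right.
have [|bt tb'] := adj_le _ adjt; first by rewrite eq_sym.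
have [|al la'] := adj_le _ adjl; first by rewrite eq_sym.
have triangle x : x != a -> x != b -> m a x != 0 -> m b x != 0 -> False.
  move=> xa xb h h'.
  have [|ax xa'] := adj_le _ h; first by rewrite eq_sym.
  have [|bx xb'] := adj_le _ h'; first by rewrite eq_sym.
  exclude [:: (x, 1 : int); (a, 1); (b, 1)].
have lt : l != t.
  by apply/eqP => e; apply: (triangle l) => //; rewrite e.
have mbl : m b l = 0 by apply/eqP/negPn/negP; apply: triangle.
have mat : m a t = 0.
  by apply/eqP/negPn/negP => h; apply: (triangle t).
have mlb : m l b = 0 by have := msym l b; have := mle0 lb; rewrite mbl; lia.
have mta : m t a = 0 by have := msym t a; have := mle0 ta; rewrite mat; lia.
have mlt : m l t = 0.
  apply/eqP/negPn/negP => h; have [//|lt1 tl1] := adj_le _ h.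
  exclude [:: (l, 1 : int); (t, 1); (a, 1); (b, 1)].
have mtl : m t l = 0 by have := msym l t; have := @mle0 t l; rewrite eq_sym lt mlt; lia.
have mal : m a l = -1.
  apply/eqP; apply/negPn/negP => /eqP h.
  have h2 : m a l <= -2 by lia.
  exclude [:: (l, 2 : int); (a, 2); (b, 2)].
have mla : m l a = -1.
  apply/eqP; apply/negPn/negP => /eqP h.
  have h2 : m l a <= -2 by lia.
  exclude [:: (l, 1 : int); (a, 2); (b, 2)].
have mbt : m b t = -1.
  apply/eqP; apply/negPn/negP => /eqP h.
  have h2 : m b t <= -2 by lia.
  exclude [:: (t, 2 : int); (b, 2); (a, 1)].
have mtb : m t b = -1.
  apply/eqP; apply/negPn/negP => /eqP h.
  have h2 : m t b <= -2 by lia.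
  exclude [:: (t, 1 : int); (b, 2); (a, 1)].
have all4 : forall j, j \in [:: l; a; b; t].
  apply: (mconn (S := mem [:: l; a; b; t])) => [i j /= hi hj|]; last first.
    by exists a; rewrite /= !inE eqxx orbT.
  move: hj; rewrite !inE !negb_or => /and4P[jl ja jb jt].
  apply/eqP/negPn/negP => adj.
  move: hi; rewrite !inE => /or4P[]/eqP ei; subst i.
  - have [|a1 a2] := adj_le _ adj; first by rewrite eq_sym.
    exclude [:: (j, 1 : int); (l, 2); (a, 3); (b, 4); (t, 2)].
  - have [|a1 a2] := adj_le _ adj; first by rewrite eq_sym.
    exclude [:: (j, 1 : int); (l, 1); (a, 2); (b, 2)].
  - have [|a1 a2] := adj_le _ adj; first by rewrite eq_sym.
    exclude [:: (j, 1 : int); (t, 1); (b, 2); (a, 1)].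
  - have [|a1 a2] := adj_le _ adj; first by rewrite eq_sym.
    exclude [:: (j, 1 : int); (l, 1); (a, 2); (b, 3); (t, 2)].
have ur : uniq [:: l; a; b; t].
  rewrite /= !inE !negb_or la lb lt ab; rewrite eq_sym in ta; rewrite eq_sym in tb.
  by rewrite ta tb.
have n4 : n = 4%N.
  have e : [:: l; a; b; t] =i enum 'I_n by move=> j; rewrite all4 mem_enum.
  by have := uniq_size_uniq ur e; rewrite enum_uniq -cardE card_ord => /esym/eqP.
split=> //; have [|s hs] := @perm_of_list [:: l; a; b; t] a _ ur; first exact: esym n4.
exists s => i j; rewrite !hs.
have lt4 (k : nat) : (k.+4 < n)%N = false by rewrite n4.
case: i => [[|[|[|[|i]]]] hi]; last by exfalso; rewrite lt4 in hi.
all: case: j => [[|[|[|[|j]]]] hj] /=; last by exfalso; rewrite lt4 in hj.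
all: by rewrite ?mii ?mla ?mlb ?mlt ?mal ?mab ?mat ?mbl ?mba ?mbt ?mtl ?mta ?mtb.
Qed.

End Dynkin.
(** * Structure constants and the characteristic *)

Section StringCoefficient.
Variables (R : realType) (n : nat).
Local Notation V := 'rV[R]_n.
Variables (Phi : {fset V}) (Delta : n.-tuple V).
Hypotheses (rsP : root_system Phi) (baseP : root_base Phi Delta)
  (irr : irreducible_roots Phi).
Local Notation al := (tnth Delta).
Local Notation m := (fun i j => cartan_int (al i) (al j)).
Let alr i : al i \in Phi. Proof. exact: al_root baseP _. Qed.
#[local] Hint Resolve alr : core.

Let mdot i j : (m i j)%:~R * dot (al j) (al j) = 2 * dot (al i) (al j).
Proof. exact: (zc_dot rsP). Qed.

Let mii i : m i i = 2.
Proof. exact: (zcaa rsP). Qed.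

Let mle0 i j : i != j -> m i j <= 0.
Proof.
by move=> ij; rewrite leNgt (zc_sgn rsP) // -leNgt; apply: al_dot_le0 rsP baseP _ _ ij.
Qed.

Let msym i j : (m i j < 0) = (m j i < 0).
Proof. exact: (zc_neg_sym rsP). Qed.

Let mlt4 i j : i != j -> m i j * m j i < 4.
Proof.
move=> ij; apply: (zc_mul_lt4 rsP) => //; rewrite 1?eq_sym.
  exact: al_neq baseP _ _ ij.
by rewrite eq_sym; apply: (al_neqN rsP baseP).
Qed.

Let mconn (S : pred 'I_n) : (forall i j, S i -> ~~ S j -> m i j = 0) ->
  (exists i, S i) -> forall j, S j.
Proof.
move=> h; apply: (simple_roots_connected rsP baseP irr) => i j Si Sj; apply/eqP.
have := mdot i j; rewrite h // mul0r => /esym/eqP.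
by rewrite mulf_eq0 pnatr_eq0.
Qed.

Let mpos (l : seq ('I_n * int)) : l != [::] -> weighted l ->
  exists2 p, p \in l & 0 < pairing m l p.1.
Proof.
move=> l0 /andP[ul /allP hl]; pose v := \sum_(q <- l) q.2%:~R *: al q.1.
have pv i : (pairing m l i)%:~R * dot (al i) (al i) = 2 * dot v (al i).
  rewrite /pairing /v dot_suml rmorph_sum mulr_suml mulr_sumr.
  by apply: eq_bigr => q _; rewrite rmorphM /= dotZl -mulrA mdot; ring.
have v0 : v != 0.
  rewrite /v; case: l l0 ul hl {v pv} => // p l _ /= /andP[pl _] hl.
  apply: contraTneq (hl p (mem_head _ _)) => /(congr1 (coord Delta p.1)).
  rewrite linear0 linear_sum big_cons /= linearZ /= (cf_al baseP) eqxx mulr1.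
  rewrite big_seq big1 ?addr0 => [/eqP|q ql].
    by rewrite intr_eq0 => /eqP ->.
  rewrite linearZ /= (cf_al baseP) (_ : (p.1 == q.1) = false) ?mulr0 //.
  by apply: contraNF pl => /eqP ->; apply: map_f.
have [/hasP[p pl hp]|/hasPn none] := boolP (has (fun p => 0 < pairing m l p.1) l).
  by exists p.
have : 0 < dot v v by rewrite dot_gt0.
rewrite {2}/v dot_sumr big_seq ltNge => /negP[]; apply: sumr_le0 => q ql.
rewrite dotZr; apply: mulr_ge0_le0; first by rewrite ler0z ltW ?hl.
rewrite -(pmulr_rle0 _ (ltr0n R 2)) -pv pmulr_lle0 ?(root_dot_gt0 rsP) //.
by rewrite lerz0 leNgt none.
Qed.

Lemma simple_double_edge i j : m i j = -2 ->
  type_B Delta \/ type_C Delta \/ type_F4 Delta.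
Proof.
have W (M : nat -> nat -> int) : (exists s : 'S_n, forall i j : 'I_n, m (s i) (s j) = M i j) ->
    has_cartan_matrix Delta M.
  by move=> [s hs]; exists s => i' j'; rewrite -hs (zcE rsP).
move=> h; have := double_edge mii mle0 msym mlt4 mconn mpos h.
by case=> [[n2 /W ?]|[[n2 /W ?]|[n4 /W ?]]]; [left|right; left|right; right].
Qed.

Lemma simple_triple_edge i j : m i j = -3 -> type_G2 Delta.
Proof.
move=> h; have [n2 [s hs]] := triple_edge mii mle0 msym mlt4 mconn mpos h.
by split=> //; exists s => i' j'; rewrite -hs (zcE rsP).
Qed.

Let m_range i j : i != j -> m i j != 0 ->
  [/\ m i j < 0, m j i < 0, -3 <= m i j & -3 <= m j i].
Proof.
move=> ij h; have := mle0 ij; have := msym i j; have := mlt4 ij.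
by move: h => /=; move: (cartan_int _ _) (cartan_int _ _) => x y *; split; nia.
Qed.

Let edge_length i j :
  (m i j)%:~R * dot (al j) (al j) = (m j i)%:~R * dot (al i) (al i).
Proof. by rewrite !mdot dotC. Qed.

(** A simple edge joins simple roots of the same length, and every root has the
    length of a simple root; so a diagram with only simple edges has roots of a
    single length. *)
Lemma unequal_lengths a b : a \in Phi -> b \in Phi -> dot a a != dot b b ->
  exists i j, m i j = -2 \/ m i j = -3.
Proof.
move=> ha hb ab; have [i ei] := root_length rsP baseP ha.
have [j ej] := root_length rsP baseP hb.
have [/existsP[i' /existsP[j' /orP[/eqP h|/eqP h]]]|none] :=
  boolP [exists i', exists j', (m i' j' == -2) || (m i' j' == -3)].
- by exists i', j'; left.
- by exists i', j'; right.
have {}none i' j' : m i' j' != -2 /\ m i' j' != -3.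
  by move: none => /existsPn/(_ i')/existsPn/(_ j'); rewrite negb_or => /andP.
case/eqP: ab; rewrite ei ej; apply/esym/eqP.
move: j {ej}; apply: (mconn (S := fun j => dot (al j) (al j) == _)); last by exists i.
move=> k j /= /eqP ek; have [<-|kj] := eqVneq k j; first by rewrite ek eqxx.
move=> ne; apply/eqP/negPn/negP => h; have [h1 h2 h3 h4] := m_range kj h.
have [n1 n2] := none k j; have [n3 n4] := none j k.
have e1 : m k j = -1 by lia.
have e2 : m j k = -1 by lia.
have := edge_length k j; rewrite [cartan_int _ _]e1 [cartan_int _ _]e2.
by move=> /(mulfI _) e; rewrite e ?ek ?eqxx // in ne; rewrite intr_eq0.
Qed.

(** Without triple edge, the squared lengths of adjacent simple roots have
    ratio 1, 2 or 1/2, so that all ratios of squared lengths are powers of 2. *)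
Lemma length_ratio3 a b : a \in Phi -> b \in Phi -> dot a a = 3 * dot b b ->
  exists i j, m i j = -3.
Proof.
move=> ha hb ab; have [i ei] := root_length rsP baseP ha.
have [j ej] := root_length rsP baseP hb.
have [/existsP[i' /existsP[j' /eqP h]]|none] :=
  boolP [exists i', exists j', m i' j' == -3]; first by exists i', j'.
have {}none i' j' : m i' j' != -3.
  by move: none => /existsPn/(_ i')/existsPn/(_ j').
exfalso; have ajp := root_dot_gt0 rsP (alr j).
have : boolp.asbool (exists x y : nat,
    2 ^+ x * dot (al i) (al i) = 2 ^+ y * dot (al j) (al j)).
  move: i {ei}; apply: (mconn (S := fun i => boolp.asbool (exists x y : nat,
    2 ^+ x * dot (al i) (al i) = 2 ^+ y * dot (al j) (al j)))); last first.
    by exists j; apply/boolp.asboolP; exists 0, 0.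
  move=> k l /boolp.asboolP[x [y e]]; have [<-|kl] := eqVneq k l.
    by move=> /boolp.asboolP[]; exists x, y.
  move=> /= /boolp.asboolPn ne; apply/eqP/negPn/negP => h; have [h1 h2 h3 h4] := m_range kl h.
  have n1 := none k l; have n2 := none l k; have lt4 := mlt4 kl.
  have el := edge_length k l.
  have : [\/ m k l = -1 /\ m l k = -1, m k l = -1 /\ m l k = -2 |
             m k l = -2 /\ m l k = -1].
    move: h1 h2 h3 h4 n1 n2 lt4 => /=.
    move: (cartan_int (al k) (al l)) (cartan_int (al l) (al k)) => s t *.
    have [?|?] : s = -1 \/ s = -2 by lia.
      have ht : t = -1 \/ t = -2 by lia.
      by case: ht => ?; [apply: Or31; split|apply: Or32; split].
    by apply: Or33; split=> //; nia.
  move=> cases; apply: ne; case: cases => -[e1 e2];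
    rewrite [cartan_int _ _]e1 [cartan_int _ _]e2 in el.
  - by exists x, y; rewrite -e; congr (_ * _); lra.
  - exists x, y.+1; rewrite exprS -mulrA -e.
    by rewrite (_ : dot (al l) (al l) = 2 * dot (al k) (al k)); [ring | lra].
  - exists x.+1, y; rewrite exprS -e.
    by rewrite (_ : dot (al k) (al k) = 2 * dot (al l) (al l)); [ring | lra].
move=> /boolp.asboolP[x [y]]; rewrite -ei -ej ab mulrA => /mulIf.
rewrite ej lt0r_neq0 // => /(_ isT) /eqP.
rewrite -!natrX -natrM eqr_nat => /eqP e.
have : (3 %| 2 ^ y)%N by rewrite -e dvdn_mull.
by rewrite Euclid_dvdX.
Qed.

(** The number r + 1 in the commutator relation of e_d and e_g, where g - r d
    is a root, is prime to p: r >= 1 forces unequal root lengths, r >= 2 a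
    triple edge, and r >= 3 is impossible because Cartan integers of
    non-proportional roots are at most 3 in absolute value. *)
Lemma string_coef_prime (p : nat) : prime p ->
    (type_B Delta \/ type_C Delta \/ type_F4 Delta -> (2 < p)%N) ->
    (type_G2 Delta -> (3 < p)%N) ->
  forall (g d : V) (r : nat), g \in Phi -> d \in Phi -> g + d \in Phi ->
    g - d *+ r \in Phi -> ~~ (p %| r.+1)%N.
Proof.
move=> pp hBCF hG g d r hg hd hgd hr.
have [->|r0] := eqVneq r 0%N; first by rewrite dvdn1 neq_ltn prime_gt1 ?orbT.
set h := g - d *+ r in hr.
have eg : g = h + r%:R *: d by rewrite scaler_nat subrK.
clearbody h.
have et : g + d = h + r.+1%:R *: d.
  by rewrite eg -addrA -{2}(scale1r d) -scalerDl -natr1.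
have dnz := root_nz rsP hd; have gnz := root_nz rsP hg.
have noscale (k : R) : h != k *: d.
  apply/eqP => e; have [e2|e2] := root_prop rsP hd hr e.
    have := root_reduced rsP (c := r.+2%:R) hd; rewrite (_ : _ *: d = g + d).
      case=> // [/eqP|e3]; first by rewrite pnatr_eq1.
      by have := ler0n R r.+2; rewrite e3 lerNr oppr0 ler10.
    by rewrite et e2 -[X in X + _]scale1r -scalerDl nat1r.
  have eg2 : g = (r%:R - 1) *: d by rewrite eg e2 scalerBl scale1r addrC.
  have egd2 : g + d = r%:R *: d by rewrite et e2 -natr1 scalerDl scale1r addrC addrK.
  have [] := root_reduced rsP (c := r%:R) hd; rewrite -?egd2 // => e3.
    by move: gnz; rewrite eg2 e3 subrr scale0r eqxx.
  by have := ler0n R r; rewrite e3 lerNr oppr0 ler10.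
have notd (x : V) (k : R) : x = h + k *: d -> (x != d) /\ (x != - d).
  move=> ->; split; apply/eqP => e.
    have := noscale (1 - k); rewrite scalerBl scale1r; apply/negP/negPn.
    by rewrite -{1}e addrK.
  have := noscale (- 1 - k); rewrite scalerBl scaleN1r; apply/negP/negPn.
  by rewrite -e addrK.
have [h1 h2] : (h != d) /\ (h != - d) by apply: (notd h 0); rewrite scale0r addr0.
have [t1 t2] := notd _ _ et.
have sw (x : V) : (x != d) -> (x != - d) -> (d != x) /\ (d != - x).
  by move=> x1 x2; split; rewrite 1?eq_sym //; apply: contraNneq x2 => <-; rewrite opprK.
have [h1' h2'] := sw _ h1 h2; have [t1' t2'] := sw _ t1 t2.
have ch := zc_abs_le3 rsP hr hd h1' h2'.
have ct := zc_abs_le3 rsP hgd hd t1' t2'.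
have ett : cartan_int (g + d) d = cartan_int h d + 2 * r.+1%:Z.
  apply: (@intr_inj R); rewrite rmorphD rmorphM /= !(zcE rsP) // et cartanDl cartanZl.
  by rewrite -(zcE rsP hd hd) (zcaa rsP) //; ring.
rewrite ett in ct; have r3 : (r <= 2)%N.
  by clear -ch ct; move: (cartan_int h d) ch ct => c; lia.
have dpos := root_dot_gt0 rsP hd.
have hdd := zc_dot rsP hr hd.
have r12 : r = 1%N \/ r = 2%N by clear -r0 r3; lia.
case: r12 => er.
- rewrite er dvdn_prime2 //; apply/eqP => p2.
  have [a [b [ha hb neq]]] : exists a b, [/\ a \in Phi, b \in Phi & dot a a != dot b b].
    have [e1|ne] := eqVneq (dot h h) (dot d d); last by exists h, d.
    exists (g + d), d; split=> //; rewrite et er; apply/negP => /eqP.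
    rewrite !(dotDl, dotDr, dotZl, dotZr) (dotC d h) e1 => e2.
    have c2 : (cartan_int h d)%:~R = -2 :> R.
      by apply: (mulIf (lt0r_neq0 dpos)); rewrite hdd; lra.
    have c3 : (cartan_int d h)%:~R = -2 :> R.
      by apply: (mulIf (lt0r_neq0 dpos)); rewrite -{1}e1 (zc_dot rsP) // dotC -hdd c2.
    have := zc_mul_lt4 rsP hr hd h1' h2'.
    by rewrite -(ltr_int R) rmorphM /= c2 c3; lra.
  have [i [j [/simple_double_edge/hBCF|/simple_triple_edge/hG]]] := unequal_lengths ha hb neq;
  by rewrite p2.
- rewrite er dvdn_prime2 //; apply/eqP => p3.
  have c3 : cartan_int h d = -3.
    by clear -ch ct er; move: (cartan_int h d) ch ct => c; lia.
  have c1 : cartan_int d h = -1.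
    have := zc_mul_lt4 rsP hr hd h1' h2'; have := zc_neg_sym rsP hr hd.
    by rewrite c3; clear; move: (cartan_int d h) => c; lia.
  have [|i [j /simple_triple_edge/hG]] := length_ratio3 hr hd; last by rewrite p3.
  have := zc_dot rsP hd hr; rewrite c1 dotC; move: hdd; rewrite c3 => e1 e2.
  by lra.
Qed.

End StringCoefficient.
(** * The integral form spanned by a Chevalley basis *)

Section ZForm.
Variables (R : realType) (n : nat).
Local Notation V := 'rV[R]_n.
Variables (Phi : {fset V}) (Delta : n.-tuple V).
Variables (L : vectType algC) (br : L -> L -> L) (e : V -> L).
Hypotheses (rsP : root_system Phi) (baseP : root_base Phi Delta)
  (chP : chevalley_basis Phi Delta br e).
Implicit Types (a b g : V) (x y z : L).
Local Notation al := (tnth Delta).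
Local Notation X := (chevalley_seq Phi Delta br e).
Local Notation d := (size X).
Local Notation hv := (coroot_vec br e).
Local Notation crd := (coord (in_tuple X)).
Local Notation bv := (tnth (in_tuple X)).

Let alr i : al i \in Phi. Proof. exact: al_root baseP _. Qed.
#[local] Hint Resolve alr : core.

(** * The bracket *)

Let lieP := chev_lie chP.

Lemma brDl x y z : br (x + y) z = br x z + br y z.
Proof. by have := lie_linearl lieP z 1 x y; rewrite !scale1r. Qed.
Lemma brDr x y z : br z (x + y) = br z x + br z y.
Proof. by have := lie_linearr lieP z 1 x y; rewrite !scale1r. Qed.
Lemma br0l z : br 0 z = 0.
Proof. by apply: (addIr (br 0 z)); rewrite -brDl !add0r. Qed.
Lemma br0r z : br z 0 = 0.
Proof. by apply: (addIr (br z 0)); rewrite -brDr !add0r. Qed.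
Lemma brZl c x z : br (c *: x) z = c *: br x z.
Proof. by have := lie_linearl lieP z c x 0; rewrite br0l !addr0. Qed.
Lemma brZr c x z : br z (c *: x) = c *: br z x.
Proof. by have := lie_linearr lieP z c x 0; rewrite br0r !addr0. Qed.
Lemma brNr x z : br z (- x) = - br z x.
Proof. by rewrite -scaleN1r brZr scaleN1r. Qed.
Lemma br_suml I (r : seq I) (f : I -> L) z :
  br (\sum_(i <- r) f i) z = \sum_(i <- r) br (f i) z.
Proof. by elim/big_rec2: _ => [|i x y _ IH]; rewrite ?br0l // brDl IH. Qed.
Lemma br_sumr I (r : seq I) (f : I -> L) z :
  br z (\sum_(i <- r) f i) = \sum_(i <- r) br z (f i).
Proof. by elim/big_rec2: _ => [|i x y _ IH]; rewrite ?br0r // brDr IH. Qed.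
Lemma brC x y : br x y = - br y x.
Proof.
apply/eqP; rewrite -addr_eq0; apply/eqP; have := lie_alternating lieP (x + y).
by rewrite brDl !brDr !(lie_alternating lieP) add0r addr0.
Qed.
Lemma br_jacobi x y z : br (br x y) z = br x (br y z) - br y (br x z).
Proof.
have := lie_jacobi lieP x y z; rewrite [br z (br x y)]brC [br z x]brC brNr.
by move=> /eqP; rewrite subr_eq0 => /eqP.
Qed.

(** * Indices and weights of the basis vectors *)

(** The weight of the i-th basis vector: 0 for the vectors h_k, which come
    first, and a for e_a. *)
Definition wt (i : 'I_d) : V := nth 0 (nseq n 0 ++ enum_fset Phi) i.

Lemma size_chev : d = (n + size (enum_fset Phi))%N.
Proof. by rewrite size_cat !size_map size_tuple. Qed.

Lemma n_le_d : (n <= d)%N. Proof. by rewrite size_chev leq_addr. Qed.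

(** The index of the basis vector h_k. *)
Definition ih (k : 'I_n) : 'I_d := widen_ord n_le_d k.

Lemma ih_inj : injective ih.
Proof. by move=> i j /(congr1 val) /= /val_inj. Qed.

Lemma bvE (i : 'I_d) : bv i = nth 0 X i.
Proof. exact: tnth_nth. Qed.

Lemma bv_ih k : bv (ih k) = hv (al k).
Proof.
rewrite bvE /= nth_cat size_map size_tuple ltn_ord.
by rewrite (nth_map 0) ?size_tuple // -tnth_nth.
Qed.

Lemma wt_ih k : wt (ih k) = 0.
Proof. by rewrite /wt nth_cat size_nseq /= ltn_ord nth_nseq ltn_ord. Qed.

Lemma idx_exists a : a \in Phi -> exists i : 'I_d, bv i = e a /\ wt i = a.
Proof.
move=> ha; have hi : (n + index a (enum_fset Phi) < d)%N.
  by rewrite size_chev ltn_add2l index_mem.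
exists (Ordinal hi); rewrite bvE /wt /= !nth_cat !size_map size_tuple size_nseq.
by rewrite ltnNge leq_addr /= addKn (nth_map 0) ?index_mem // nth_index.
Qed.

Lemma idx_cases (i : 'I_d) :
  (exists k, i = ih k) \/ (wt i \in Phi /\ bv i = e (wt i)).
Proof.
have [ni|ni] := ltnP i n; [left|right].
  by exists (Ordinal ni); apply: val_inj.
have hi : (i - n < size (enum_fset Phi))%N.
  by rewrite ltn_subLR // -size_chev.
rewrite bvE /wt !nth_cat !size_map size_tuple size_nseq ltnNge ni /=.
by rewrite (nth_map 0) // mem_nth.
Qed.

Lemma idx_uniq (i j : 'I_d) : wt i \in Phi -> wt i = wt j -> i = j.
Proof.
have H (k : 'I_d) : wt k \in Phi ->
    (n <= k)%N /\ wt k = nth 0 (enum_fset Phi) (k - n).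
  move=> hk; case: (idx_cases k) => [[k' e1]|_].
    by have := root_nz rsP hk; rewrite e1 wt_ih eqxx.
  have [nk|nk] := ltnP k n.
    by have := root_nz rsP hk; rewrite (_ : k = ih (Ordinal nk)) ?wt_ih ?eqxx //; apply: val_inj.
  by split=> //; rewrite /wt nth_cat size_nseq ltnNge nk.
move=> hi eij; have [ni ei] := H i hi; have hj := hi; rewrite eij in hj.
have [nj ej] := H j hj; apply: val_inj.
have B (k : 'I_d) : (n <= k)%N -> (k - n < size (enum_fset Phi))%N.
  by move=> nk; rewrite ltn_subLR // -size_chev.
have /eqP := eij; rewrite ei ej nth_uniq ?B ?fset_uniq // => /eqP eq.
by rewrite /= -(subnK ni) -(subnK nj) eq.
Qed.

Lemma crd_bv (i j : 'I_d) : crd i (bv j) = (i == j)%:R.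
Proof.
have /basis_free fr := chev_basis chP.
by rewrite (tnth_nth 0) coord_free // eq_sym.
Qed.

Lemma bv_expand x : x = \sum_j crd j x *: bv j.
Proof.
rewrite {1}(coord_basis (chev_basis chP : basis_of fullv (in_tuple X)) (memvf x)).
by apply: eq_bigr => i _; rewrite -tnth_nth.
Qed.

Lemma crd_inj x y : (forall i, crd i x = crd i y) -> x = y.
Proof. by move=> h; rewrite (bv_expand x) (bv_expand y); apply: eq_bigr => i _; rewrite h. Qed.

(** * Coroots *)

Lemma zc0 b : cartan_int 0 b = 0.
Proof. by rewrite /cartan_int /cartan dot0l mulr0 mul0r floor0. Qed.

Lemma br_hv_bv b i : b \in Phi -> br (hv b) (bv i) = (cartan_int (wt i) b)%:~R *: bv i.
Proof.
move=> hb; case: (idx_cases i) => [[k ->]|[hi ->]].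
  by rewrite bv_ih wt_ih zc0 scale0r (chev_hh chP).
by rewrite (chev_he chP).
Qed.

Lemma hv_opp a : hv (- a) = - hv a.
Proof. by rewrite /coroot_vec opprK brC. Qed.

(** The coroot vector of a commutes with all coroot vectors, so it has no
    component on the e_b. *)
Lemma hv_span a : a \in Phi -> hv a = \sum_k crd (ih k) (hv a) *: hv (al k).
Proof.
move=> ha; set x := hv a.
have z j : wt j \in Phi -> crd j x = 0.
  move=> hj; have : br (hv (wt j)) x = 0 by apply: (chev_hh chP).
  rewrite {1}(bv_expand x) br_sumr => /(congr1 (crd j)).
  rewrite linear_sum linear0 /= (bigD1 j) //= big1 => [|i ij]; last first.
    by rewrite brZr br_hv_bv // scalerA linearZ /= crd_bv eq_sym (negPf ij) mulr0.
  rewrite addr0 brZr br_hv_bv // scalerA linearZ /= crd_bv eqxx mulr1.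
  by rewrite (zcaa rsP) // => /eqP; rewrite mulf_eq0 intr_eq0 orbF => /eqP.
apply: crd_inj => j; rewrite linear_sum /=.
under eq_bigr => k _ do rewrite linearZ /= -bv_ih crd_bv.
case: (idx_cases j) => [[k ->]|[hj _]].
  rewrite (bigD1 k) //= eqxx mulr1 big1 ?addr0 // => i ik.
  by rewrite (inj_eq ih_inj) eq_sym (negPf ik) mulr0.
rewrite z // big1 // => k _; case: eqP => [ejk|_]; last by rewrite mulr0.
by have := root_nz rsP hj; rewrite ejk wt_ih eqxx.
Qed.

Definition cartan_mx : 'M[int]_n := \matrix_(j, k) cartan_int (al j) (al k).

(** The Cartan matrix is invertible over R because the simple coroots are a
    basis; being integral, it remains so over algC. *)
Lemma cartan_mx_det : \det cartan_mx != 0.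
Proof.
rewrite -det_tr -(intr_eq0 R) -det_map_mx; apply/det0P => -[y y0 hy].
pose w := \sum_k (2 * y 0 k / dot (al k) (al k)) *: al k.
have wj j : dot w (al j) = 0.
  have := congr1 (fun M : 'rV_n => M 0 j) hy; rewrite !mxE => <-.
  rewrite dot_suml; apply: eq_bigr => k _.
  by rewrite dotZl !mxE /= (zcE rsP) // /cartan (dotC (al k)); ring.
have w0 : w = 0.
  apply/eqP; rewrite -dot_eq0 {2}(cfE baseP w) dot_sumr big1 // => j _.
  by rewrite dotZr wj mulr0.
case/eqP: y0; apply/rowP => j; rewrite mxE.
have := congr1 (coord Delta j) w0; rewrite linear0 linear_sum (bigD1 j) //=.
rewrite big1 => [|k kj]; last by rewrite linearZ /= (cf_al baseP) eq_sym (negPf kj) mulr0.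
rewrite linearZ /= (cf_al baseP) eqxx mulr1 addr0 => /eqP.
have aj := root_dot_gt0 rsP (alr j).
by rewrite !mulf_eq0 invr_eq0 (negPf (lt0r_neq0 aj)) pnatr_eq0 orbF => /eqP.
Qed.

(** Both sides lie in the span of the h_k and act on the e_b, with b simple, by
    the same integers, and the Cartan matrix is invertible. *)
Lemma hv_coord a : posr Phi Delta a -> exists c b : 'I_n -> int,
  hv a = \sum_k (c k)%:~R *: hv (al k) /\ \sum_k b k * c k = 1.
Proof.
move=> pa; have ha := posr_root pa.
have [c [b [hc hb]]] := coroot_coord rsP baseP pa; exists c, b; split=> //.
pose y : 'cV[algC]_n := \col_k (crd (ih k) (hv a) - (c k)%:~R).
suff y0 : y = 0.
  rewrite hv_span //; apply: eq_bigr => k _; congr (_ *: _).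
  have := congr1 (fun M : 'cV_n => M k 0) y0; rewrite !mxE => /eqP.
  by rewrite subr_eq0 => /eqP.
pose C := map_mx intr cartan_mx : 'M[algC]_n.
have uC : C \in unitmx.
  by rewrite unitmxE unitfE det_map_mx intr_eq0 cartan_mx_det.
apply: (can_inj (mulKmx uC)); rewrite mulmx0; apply/colP => j; rewrite !mxE.
have [i [ei wi]] := idx_exists (alr j).
have E1 : (cartan_int (al j) a)%:~R =
    \sum_k crd (ih k) (hv a) * (cartan_int (al j) (al k))%:~R :> algC.
  have c1 : crd i (e (al j)) = 1 by rewrite -ei crd_bv eqxx.
  have := congr1 (crd i) (chev_he chP ha (alr j)).
  rewrite {1}hv_span // br_suml linear_sum linearZ /= c1 mulr1 => <-.
  apply: eq_bigr => k _.
  by rewrite brZl (chev_he chP) // scalerA linearZ /= c1 mulr1.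
have E2 : cartan_int (al j) a = \sum_k c k * cartan_int (al j) (al k).
  apply: (@intr_inj R); rewrite (zcE rsP) // hc rmorph_sum; apply: eq_bigr => k _.
  by rewrite rmorphM /= (zcE rsP).
transitivity (\sum_k crd (ih k) (hv a) * (cartan_int (al j) (al k))%:~R
               - \sum_k ((c k)%:~R * (cartan_int (al j) (al k))%:~R) : algC).
  by rewrite -sumrB; apply: eq_bigr => k _; rewrite !mxE; ring.
rewrite -E1 E2 rmorph_sum; apply/eqP; rewrite subr_eq0; apply/eqP.
by apply: eq_bigr => k _; rewrite rmorphM.
Qed.

Lemma hv_int a j : a \in Phi -> crd j (hv a) \is a Num.int.
Proof.
have H b : posr Phi Delta b -> crd j (hv b) \is a Num.int.
  move=> /hv_coord[c [_ [-> _]]]; rewrite linear_sum rpred_sum // => k _.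
  by rewrite linearZ /= -bv_ih crd_bv rpredM ?rpred_int ?rpred_nat.
move=> ha; case/orP: (root_sign baseP ha) => h; first by apply: H; rewrite /posr ha.
rewrite -[a]opprK hv_opp linearN rpredN; apply: H.
by rewrite /posr (root_opp rsP).
Qed.

Lemma hv_wt a j : a \in Phi -> crd j (hv a) != 0 -> wt j = 0.
Proof.
move=> ha; rewrite hv_span // linear_sum /=; case: (eqVneq (wt j) 0) => // wj.
rewrite big1 ?eqxx // => k _; rewrite linearZ /= -bv_ih crd_bv.
case: (eqVneq j (ih k)) => [e1|]; last by rewrite mulr0.
by rewrite e1 wt_ih eqxx in wj.
Qed.

Lemma crd_e a j : a \in Phi -> crd j (e a) = (wt j == a)%:R.
Proof.
move=> ha; have [i [ei wi]] := idx_exists ha; rewrite -ei crd_bv; congr (_%:R).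
congr (nat_of_bool _); apply/eqP/eqP => [->//|wj].
by apply: idx_uniq; rewrite wj // wi.
Qed.

(** * Root strings and divided powers *)

Section RootString.
Variables (a b : V).
Hypotheses (ha : a \in Phi) (hb : b \in Phi) (nab : b != a) (nabN : b != - a).

Lemma string_neq0 k : b + a *+ k != 0.
Proof.
apply/eqP => e0; have e1 : b = (- k%:R) *: a.
  by rewrite scaleNr scaler_nat; apply/eqP; rewrite -addr_eq0 e0.
case: (root_prop rsP ha hb e1) => e2; first by move: nab; rewrite e2 eqxx.
by move: nabN; rewrite e2 eqxx.
Qed.

(** Down an a-string, Cartan integers with a decrease by 2 at each step, and
    they are at least -3. *)
Lemma string_max : exists r, b - a *+ r \in Phi /\
  forall k, (r < k)%N -> b - a *+ k \notin Phi.
Proof.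
have ex : exists r, b - a *+ r \in Phi by exists 0; rewrite mulr0n subr0.
have bd r : b - a *+ r \in Phi -> (r <= 3)%N.
  move=> hr; have np c : b - a *+ r != c *: a.
    apply/eqP => e0; have e1 : b = (c + r%:R) *: a.
      by rewrite scalerDl scaler_nat -e0 subrK.
    case: (root_prop rsP ha hb e1) => e2; first by move: nab; rewrite e2 eqxx.
    by move: nabN; rewrite e2 eqxx.
  have n1 : a != b - a *+ r by rewrite eq_sym -[X in _ != X]scale1r np.
  have n2 : a != - (b - a *+ r).
    by rewrite -eqr_oppLR -[X in X != _]scaleN1r eq_sym np.
  have := zc_abs_le3 rsP hr ha n1 n2.
  have n3 : a != b by rewrite eq_sym.
  have n4 : a != - b by rewrite -eqr_oppLR eq_sym.
  have := zc_abs_le3 rsP hb ha n3 n4.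
  have -> : cartan_int (b - a *+ r) a = cartan_int b a - 2 * r%:Z.
    apply: (@intr_inj R); rewrite rmorphB rmorphM /= !(zcE rsP) // cartanBl.
    by rewrite -scaler_nat cartanZl -(zcE rsP ha ha) (zcaa rsP) //; ring.
  by clear; move: (cartan_int b a) => c; lia.
case: (ex_maxnP ex bd) => r hr mx; exists r; split=> // k; rewrite ltnNge.
by apply: contra => /mx.
Qed.

(** Up to sign, the successive factors are r + 1, ..., r + k, where b - r a is
    the origin of the a-string through b, and their product is
    k! binom(r + k, k). *)
Lemma string_iter k :
  iter k (br (e a)) (e b) = 0 \/
  (forall j, (j <= k)%N -> b + a *+ j \in Phi) /\
  exists c : int, iter k (br (e a)) (e b) = (k`!%:Z * c)%:~R *: e (b + a *+ k).
Proof.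
have [r [hr mx]] := string_max.
suff : iter k (br (e a)) (e b) = 0 \/
  (forall j, (j <= k)%N -> b + a *+ j \in Phi) /\
  exists c : int, iter k (br (e a)) (e b) =
    (c * ((r + k) ^_ k)%:Z)%:~R *: e (b + a *+ k).
  case=> [->|[h [c hc]]]; [by left|right; split=> //].
  exists (c * 'C(r + k, k)%:Z); rewrite hc -bin_ffact PoszM.
  by congr (_%:~R *: _); ring.
elim: k => [|k [IH|[IHr [c IH]]]].
- right; split=> [j|]; first by rewrite leqn0 => /eqP ->; rewrite mulr0n addr0.
  by exists 1; rewrite /= mulr0n addr0 ffactn0 mulr1 scale1r.
- by left; rewrite iterS IH br0r.
have hbk := IHr k (leqnn k); rewrite iterS IH brZr.
have eS : a + (b + a *+ k) = b + a *+ k.+1 by rewrite mulrS addrCA.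
have [h|h] := boolP (b + a *+ k.+1 \in Phi); last first.
  by left; rewrite (chev_ee0 chP) ?eS ?scaler0 // string_neq0.
right; split=> [j|].
  by rewrite leq_eqVlt => /orP[/eqP ->//|]; apply: IHr.
have h1 : b + a *+ k - a *+ (r + k) \in Phi.
  by rewrite mulrnDr opprD addrACA subrr addr0.
have h2 j : (r + k < j)%N -> b + a *+ k - a *+ j \notin Phi.
  move=> hj; rewrite -(@subnK k j) ?(leq_trans (leq_addl r k) (ltnW hj)) //.
  by rewrite mulrnDr opprD addrACA subrr addr0 mx // ltn_subRL addnC.
have := chev_ee chP ha hbk; rewrite eS => /(_ _ h h1 h2).
rewrite addnS ffactSS PoszM => -[] ->; [exists c|exists (- c)].
  by rewrite scalerA [X in _ * X]pmulrn -intrM; congr (_%:~R *: _); ring.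
rewrite scalerN scalerA -scaleNr [X in _ * X]pmulrn -intrM -rmorphN.
by congr (_%:~R *: _) => /=; ring.
Qed.

(** The roots of an a-string are distinct, so there are fewer than d of them:
    sums truncated at d contain the whole exponential of ad e_a. *)
Lemma string_short k :
  (forall j, (j <= k)%N -> b + a *+ j \in Phi) -> (k < size (enum_fset Phi))%N.
Proof.
move=> h; have inj : injective (fun j : nat => b + a *+ j).
  move=> i j /addrI /eqP; rewrite -!scaler_nat -subr_eq0 -scalerBl scaler_eq0.
  by rewrite (negPf (root_nz rsP ha)) orbF subr_eq0 eqr_nat => /eqP.
have := @uniq_leq_size _ (mkseq (fun j : nat => b + a *+ j) k.+1) (enum_fset Phi).
rewrite size_mkseq; apply; first by rewrite mkseq_uniq.
by move=> x /mapP[j]; rewrite mem_iota /= => jk ->; apply: h.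
Qed.

End RootString.

Lemma d_ge3 a : a \in Phi -> (2 < d)%N.
Proof.
move=> ha; have n0 : (0 < n)%N.
  rewrite lt0n; apply: contraNneq (root_nz rsP ha) => n0.
  by apply/eqP/rowP => i; have := ltn_ord i; rewrite {2}n0.
have : (1 < size (enum_fset Phi))%N.
  apply: (@uniq_leq_size _ [:: a; - a]) => [|x].
    rewrite /= inE andbT; apply/eqP => e1; have := root_dot_gt0 rsP ha.
    by rewrite {1}e1 dotNl; have := dot_ge0 a; lra.
  by rewrite !inE => /orP[/eqP ->|/eqP ->] //; apply: root_opp.
by rewrite size_chev; lia.
Qed.

Lemma ad_iter a i k : a \in Phi -> (0 < k)%N ->
  iter k (br (e a)) (bv i) = 0 \/ (k < d)%N /\
    ((exists g (c : int), [/\ g \in Phi, g = wt i + a *+ k &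
        iter k (br (e a)) (bv i) = (k`!%:Z * c)%:~R *: e g]) \/
     [/\ k = 1%N, wt i = - a & iter k (br (e a)) (bv i) = hv a]).
Proof.
move=> ha k0; have d3 := d_ge3 ha.
have eaa : br (e a) (e a) = 0 by apply: lie_alternating lieP _.
have z0 m : iter m (br (e a)) 0 = 0 by elim: m => //= m ->; rewrite br0r.
case: k k0 => // k _.
case: (idx_cases i) => [[j ->]|[hi ->]].
  have e1 : br (e a) (hv (al j)) = (- cartan_int a (al j))%:~R *: e a.
    by rewrite brC (chev_he chP) // -scaleNr -rmorphN.
  case: k => [|k]; last first.
    by left; rewrite iterSr bv_ih e1 iterSr brZr eaa scaler0 z0.
  right; split; first by apply: ltn_trans d3.
  left; exists a, (- cartan_int a (al j)); split=> //; first by rewrite wt_ih add0r.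
  by rewrite bv_ih /= e1 mul1r.
have [->|na] := eqVneq (wt i) a; first by left; rewrite iterSr eaa z0.
have [->|nN] := eqVneq (wt i) (- a).
  have e1 : br (e a) (e (- a)) = hv a by [].
  have e2 : br (e a) (hv a) = (-2)%:~R *: e a.
    by rewrite brC (chev_he chP) // -scaleNr -rmorphN /= -/(cartan_int a a) (zcaa rsP).
  case: k => [|[|k]].
  - by right; split; [apply: ltn_trans d3 | right].
  - right; split=> //; left; exists a, (-1); split=> //.
    by rewrite mulr2n addKr.
  - by left; rewrite 2!iterSr e1 e2 iterSr brZr eaa scaler0 z0.
case: (string_iter ha hi na nN k.+1) => [->|[h [c hc]]]; [by left|right].
split; first by rewrite size_chev; have := string_short ha h; lia.
by left; exists (wt i + a *+ k.+1), c; split=> //; apply: h.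
Qed.

(** The matrix of (ad e_a)^k / k! on row vectors of coordinates. *)
Definition divad_C a k : 'M[algC]_d :=
  \matrix_(i, j) crd j (k`!%:R^-1 *: iter k (br (e a)) (bv i)).

Definition ad_C x : 'M[algC]_d := \matrix_(i, j) crd j (br x (bv i)).

Let fact_neq0 k : k`!%:R != 0 :> algC.
Proof. by rewrite pnatr_eq0 -lt0n fact_gt0. Qed.

Lemma divad_C0 a : divad_C a 0 = 1.
Proof. by apply/matrixP => i j; rewrite !mxE /= invr1 scale1r crd_bv eq_sym. Qed.

Lemma divad_C1 a : divad_C a 1 = ad_C (e a).
Proof. by apply/matrixP => i j; rewrite !mxE /= invr1 scale1r. Qed.

Lemma divad_C_int a k i j : a \in Phi -> divad_C a k i j \is a Num.int.
Proof.
move=> ha; case: (posnP k) => [->|k0].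
  by rewrite divad_C0 mxE rpred_nat.
rewrite mxE linearZ /=; case: (ad_iter i ha k0) => [->|[_ [[g [c [hg _ ->]]]|[-> _ ->]]]].
- by rewrite linear0 mulr0 rpred0.
- rewrite linearZ /= crd_e // rmorphM /= mulrA mulrA mulVf ?fact_neq0 // mul1r.
  by rewrite rpredM ?rpred_int ?rpred_nat.
- by rewrite invr1 mul1r hv_int.
Qed.

Lemma divad_C_nilp a k : a \in Phi -> (d <= k)%N -> divad_C a k = 0.
Proof.
move=> ha dk; apply/matrixP => i j; rewrite !mxE.
have k0 : (0 < k)%N by have := d_ge3 ha; lia.
case: (ad_iter i ha k0) => [->|[]]; first by rewrite scaler0 linear0.
by rewrite ltnNge dk.
Qed.

Lemma divad_C_supp a k i j : a \in Phi -> divad_C a k i j != 0 -> wt j = wt i + a *+ k.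
Proof.
move=> ha; case: (posnP k) => [->|k0].
  rewrite divad_C0 mxE mulr0n addr0; case: (eqVneq i j) => [->//|_].
  by rewrite eqxx.
rewrite mxE linearZ /=.
case: (ad_iter i ha k0) => [->|[_ [[g [c [hg eg ->]]]|[-> ei ->]]]].
- by rewrite linear0 mulr0 eqxx.
- by rewrite linearZ /= crd_e // -eg; case: (eqVneq (wt j) g) => // _;
    rewrite !mulr0 eqxx.
- by rewrite ei addNr invr1 mul1r; apply: hv_wt.
Qed.

Lemma ad_C_hv k i j :
  ad_C (hv (al k)) i j = (i == j)%:R * (cartan_int (wt i) (al k))%:~R.
Proof. by rewrite mxE br_hv_bv // linearZ /= crd_bv eq_sym mulrC. Qed.

Lemma ad_C_expand x : ad_C x = \sum_j crd j x *: ad_C (bv j).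
Proof.
apply/matrixP => i k; rewrite summxE mxE {1}(bv_expand x) br_suml linear_sum.
by apply: eq_bigr => j _; rewrite !mxE brZl linearZ.
Qed.

Lemma ad_C_act x y j : \sum_i crd i y * ad_C x i j = crd j (br x y).
Proof.
rewrite {2}(bv_expand y) br_sumr linear_sum; apply: eq_bigr => i _.
by rewrite mxE brZr linearZ.
Qed.

(** As matrices act on the right of row vectors, ad is an antihomomorphism. *)
Lemma ad_C_br x y : ad_C (br x y) = ad_C y *m ad_C x - ad_C x *m ad_C y.
Proof.
apply/matrixP => i j; rewrite !mxE br_jacobi linearB /= -!ad_C_act.
by congr (_ - _); apply: eq_bigr => k _; rewrite !mxE.
Qed.

Lemma divad_CS a k : divad_C a k *m ad_C (e a) = k.+1%:R *: divad_C a k.+1.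
Proof.
apply/matrixP => i j; rewrite !mxE.
under eq_bigr => l _ do rewrite mxE.
rewrite ad_C_act brZr !linearZ /= factS natrM invfM mulrA mulrA.
by rewrite divff ?mul1r // pnatr_eq0.
Qed.

(** The divided powers of ad e_a satisfy the Leibniz rule; in matrix terms
    this expresses that exp (t ad e_a) is an automorphism. *)
Lemma divad_C_leibniz a x m : ad_C x *m divad_C a m =
  \sum_(k < m.+1) divad_C a k *m ad_C ((m - k)`!%:R^-1 *: iter (m - k) (br (e a)) x).
Proof.
pose xl l := l`!%:R^-1 *: iter l (br (e a)) x.
have xlS l : br (e a) (xl l) = l.+1%:R *: xl l.+1.
  by rewrite /xl brZr scalerA factS natrM invfM mulrA divff ?mul1r // pnatr_eq0.
have admZ c y : ad_C (c *: y) = c *: ad_C y.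
  by apply/matrixP => i j; rewrite !mxE brZl linearZ.
have xl0 : xl 0%N = x by rewrite /xl invr1 scale1r.
rewrite -[RHS]/(\sum_(k < m.+1) divad_C a k *m ad_C (xl (m - k)%N)); clearbody xl.
elim: m => [|m IH].
  by rewrite big_ord_recl big_ord0 addr0 subnn divad_C0 mulmx1 mul1mx xl0.
have m0 : m.+1%:R != 0 :> algC by rewrite pnatr_eq0.
apply: (scalerI m0); rewrite scalemxAr -divad_CS mulmxA IH mulmx_suml.
have com y : ad_C y *m ad_C (e a) = ad_C (e a) *m ad_C y + ad_C (br (e a) y).
  by rewrite ad_C_br addrC subrK.
under eq_bigr => k _ do rewrite -mulmxA com mulmxDr xlS admZ -scalemxAr mulmxA divad_CS -scalemxAl.
rewrite big_split /= scaler_sumr.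
have -> : \sum_(k < m.+2) m.+1%:R *: (divad_C a k *m ad_C (xl (m.+1 - k)%N)) =
  \sum_(k < m.+2) k%:R *: (divad_C a k *m ad_C (xl (m.+1 - k)%N)) +
  \sum_(k < m.+2) (m.+1 - k)%:R *: (divad_C a k *m ad_C (xl (m.+1 - k)%N)).
  rewrite -big_split /=; apply: eq_bigr => k _.
  by rewrite -scalerDl -natrD subnKC // -ltnS.
congr (_ + _); first by rewrite [RHS]big_ord_recl scale0r add0r.
rewrite [RHS]big_ord_recr /= subnn scale0r addr0; apply: eq_bigr => k _.
by rewrite subSn // -ltnS.
Qed.

End ZForm.
(** * Root elements over a commutative ring *)

Section RootElements.
Variables (R : realType) (n : nat).
Local Notation V := 'rV[R]_n.
Variables (Phi : {fset V}) (Delta : n.-tuple V).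
Variables (L : vectType algC) (br : L -> L -> L) (e : V -> L).
Hypotheses (rsP : root_system Phi) (baseP : root_base Phi Delta)
  (chP : chevalley_basis Phi Delta br e).
Implicit Types (a b g : V).
Local Notation al := (tnth Delta).
Local Notation X := (chevalley_seq Phi Delta br e).
Local Notation d := (size X).
Local Notation hv := (coroot_vec br e).
Local Notation crd := (coord (in_tuple X)).
Local Notation bv := (tnth (in_tuple X)).
Local Notation ih := (ih Phi Delta br e).
Local Notation divad_C := (divad_C Phi Delta br e).
Local Notation ad_C := (ad_C Phi Delta br e).

Let alr i : al i \in Phi. Proof. exact: al_root baseP _. Qed.
#[local] Hint Resolve alr : core.

(** * Integral matrices of the Chevalley basis *)

Definition divad_int a k : 'M[int]_d := map_mx Num.floor (divad_C a k).
Definition ad_int (l : 'I_d) : 'M[int]_d := map_mx Num.floor (ad_C (bv l)).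

Lemma divad_intE a k : a \in Phi -> map_mx intr (divad_int a k) = divad_C a k.
Proof.
move=> ha; apply/matrixP => i j; rewrite mxE /divad_int [X in X%:~R]mxE.
by rewrite floorK // (divad_C_int rsP baseP chP).
Qed.

Lemma ad_int_root a l : a \in Phi -> wt l = a -> ad_int l = divad_int a 1.
Proof.
move=> ha wl; rewrite /divad_int divad_C1 //; congr (map_mx _ (ad_C _)).
case: (idx_cases l) => [[k el]|[_ ->]]; last by rewrite wl.
by have := root_nz rsP ha; rewrite -wl el wt_ih eqxx.
Qed.

Lemma ad_int_h k i j : ad_int (ih k) i j = (i == j)%:R * cartan_int (wt i) (al k).
Proof.
rewrite mxE bv_ih (ad_C_hv baseP chP).
by rewrite [_%:R]pmulrn -intrM intrKfloor pmulrn intz.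
Qed.

Lemma ad_intE l : map_mx intr (ad_int l) = ad_C (bv l).
Proof.
case: (idx_cases l) => [[k ->]|[hl el]].
  by apply/matrixP => i j; rewrite mxE ad_int_h bv_ih (ad_C_hv baseP chP) rmorphM /= rmorph_nat.
by rewrite (ad_int_root hl) // divad_intE // divad_C1 // el.
Qed.

Lemma intr_mx_inj (r s : nat) (M N : 'M[int]_(r, s)) :
  map_mx intr M = map_mx intr N :> 'M[algC]_(r, s) -> M = N.
Proof.
move=> h; apply/matrixP => i j; apply: (@intr_inj algC).
by have := congr1 (fun Z : 'M_(r, s) => Z i j) h; rewrite !mxE.
Qed.

Lemma divad_int0 a : a \in Phi -> divad_int a 0 = 1.
Proof.
move=> ha; apply: intr_mx_inj; rewrite divad_intE // divad_C0 //.
by apply/matrixP => i j; rewrite !mxE rmorph_nat.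
Qed.

Lemma divad_int_nilp a k : a \in Phi -> (d <= k)%N -> divad_int a k = 0.
Proof.
move=> ha dk; apply: intr_mx_inj; rewrite divad_intE // (divad_C_nilp rsP baseP chP) //.
by rewrite map_mx0.
Qed.

Lemma divad_int_supp a k i j : a \in Phi -> divad_int a k i j != 0 -> wt j = wt i + a *+ k.
Proof.
move=> ha; rewrite -(intr_eq0 algC) => h; apply: (divad_C_supp rsP baseP chP) => //.
by rewrite -divad_intE // mxE.
Qed.

Lemma ad_int_supp l i j : ad_int l i j != 0 -> wt j = wt i + wt l.
Proof.
case: (idx_cases l) => [[k ->]|[hl _]].
  rewrite ad_int_h wt_ih addr0; case: (eqVneq i j) => [->//|_].
  by rewrite mul0r eqxx.
by rewrite (ad_int_root hl) // => /(divad_int_supp hl); rewrite mulr1n.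
Qed.

Lemma divad_int_leibniz a l m : a \in Phi -> ad_int l *m divad_int a m =
  \sum_(k < m.+1) divad_int a k *m \sum_j divad_int a (m - k) l j *: ad_int j.
Proof.
move=> ha; apply: intr_mx_inj; rewrite map_mxM ad_intE divad_intE // divad_C_leibniz // raddf_sum.
apply: eq_bigr => k _; rewrite /= map_mxM divad_intE //; congr (_ *m _).
rewrite ad_C_expand // raddf_sum; apply: eq_bigr => j _.
rewrite /= map_mxZ ad_intE; congr (_ *: _).
by have := congr1 (fun Z : 'M_d => Z l j) (divad_intE (m - k) ha); rewrite mxE [RHS]mxE.
Qed.

(** As [e_a, e_(-a)] is the coroot vector of a, the Bezout relation for the
    coordinates of coroots is one for the entries of the row of e_(-a) in
    ad e_a. Hence ad e_a does not vanish modulo any prime, and c is an integral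
    combination of the entries of c ad e_a. *)
Lemma divad_int_bezout a : posr Phi Delta a -> exists (i : 'I_d) (b : 'I_n -> int),
  wt i = - a /\ \sum_k b k * divad_int a 1 i (ih k) = 1.
Proof.
move=> pa; have ha := posr_root pa.
have [i [ei wi]] := idx_exists Delta br e (root_opp rsP ha).
have [c [b [hc hb]]] := hv_coord rsP baseP chP pa.
exists i, b; split=> //; rewrite -hb; apply: eq_bigr => k _; congr (_ * _).
apply: (@intr_inj algC).
rewrite -[LHS](_ : map_mx intr (divad_int a 1) i (ih k) = _); last by rewrite mxE.
rewrite divad_intE // divad_C1 mxE ei -[br _ _]/(hv a) hc linear_sum (bigD1 k) //=.
rewrite linearZ /= -(bv_ih Phi Delta) (crd_bv chP) eqxx mulr1 big1 ?addr0 // => j jk.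
rewrite linearZ /= -(bv_ih Phi Delta) (crd_bv chP) (inj_eq (@ih_inj _ _ _ _ _ _ _)).
by rewrite eq_sym (negPf jk) mulr0.
Qed.

(** The coefficient c is a structure constant +-(r + 1). *)
Lemma divad_int_comm a g : a \in Phi -> g \in Phi -> g + a \in Phi ->
  exists (c : int) (r : nat), [/\ g - a *+ r \in Phi, `|c|%N = r.+1 &
    divad_int g 1 *m divad_int a 1 - divad_int a 1 *m divad_int g 1 = c *: divad_int (g + a) 1].
Proof.
move=> ha hg hga.
have nga : g != a.
  apply/eqP => e1; rewrite e1 -mulr2n -scaler_nat in hga.
  case: (root_reduced rsP ha hga) => [/eqP|e3]; first by rewrite pnatr_eq1.
  by have := ler0n R 2; rewrite e3 lerNr oppr0 ler10.
have ngaN : g != - a.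
  by apply/eqP => e1; have := root_nz rsP hga; rewrite e1 addNr eqxx.
have [r [hr mx]] := string_max rsP ha hg nga ngaN.
have E : exists c : int, `|c|%N = r.+1 /\ br (e a) (e g) = c%:~R *: e (g + a).
  have hag : a + g \in Phi by rewrite addrC.
  have := chev_ee chP ha hg hag hr mx; rewrite addrC => -[] ->.
    by exists r.+1%:Z; split.
  by exists (- r.+1%:Z); split; rewrite ?abszN // rmorphN scaleNr.
have [c [nc hc]] := E; exists c, r; split=> //; apply: intr_mx_inj.
rewrite map_mxB !map_mxM !divad_intE // map_mxZ divad_intE // !divad_C1 -ad_C_br // hc.
by apply/matrixP => i j; rewrite !mxE (brZl chP) linearZ.
Qed.

(** * Supports of matrices *)

(** The support of M is the set of weights w such that M has a component
    mapping some weight space to the one shifted by w. *)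
Definition supp (K : pzRingType) (S : pred V) (M : 'M[K]_d) : Prop :=
  forall i j, M i j != 0 -> S (wt j - wt i).

Section Support.
Variable K : pzRingType.
Implicit Types (S T W : pred V) (M N : 'M[K]_d).

Lemma suppE S M i j : supp S M -> ~~ S (wt j - wt i) -> M i j = 0.
Proof. by move=> h; apply: contraNeq => /h. Qed.

Lemma supp_sub S T M : supp S M -> (forall x, S x -> T x) -> supp T M.
Proof. by move=> h st i j /h; apply: st. Qed.

Lemma supp0 S : supp S (0 : 'M[K]_d).
Proof. by move=> i j; rewrite mxE eqxx. Qed.

Lemma suppD S M N : supp S M -> supp S N -> supp S (M + N).
Proof.
move=> hM hN i j; rewrite mxE; case: (eqVneq (M i j) 0) => [->|/hM //].
by rewrite add0r => /hN.
Qed.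

Lemma suppN S M : supp S M -> supp S (- M).
Proof. by move=> hM i j; rewrite mxE oppr_eq0 => /hM. Qed.

Lemma suppB S M N : supp S M -> supp S N -> supp S (M - N).
Proof. by move=> hM hN; apply: suppD => //; apply: suppN. Qed.

Lemma suppZ S c M : supp S M -> supp S (c *: M).
Proof.
move=> hM i j; rewrite mxE => h; apply: hM.
by apply: contraNneq h => ->; rewrite mulr0.
Qed.

Lemma supp_sum I (r : seq I) (P : pred I) S (f : I -> 'M[K]_d) :
  (forall i, P i -> supp S (f i)) -> supp S (\sum_(i <- r | P i) f i).
Proof. by move=> h; apply: (big_ind (supp S)); [exact: supp0 | exact: suppD |]. Qed.

Lemma suppM S T W M N : (forall x y, S x -> T y -> W (x + y)) ->
  supp S M -> supp T N -> supp W (M *m N).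
Proof.
move=> st hM hN i j; rewrite mxE => h.
have [/existsP[k]|/existsPn none] :=
    boolP [exists k, (M i k != 0) && (N k j != 0)].
  case/andP => /hM h1 /hN h2; have := st _ _ h1 h2.
  by rewrite addrC addrA subrK.
case/eqP: h; rewrite big1 // => k _; have := none k.
rewrite negb_and !negbK => /orP[]/eqP ->; by rewrite ?mul0r ?mulr0.
Qed.

End Support.

Lemma supp_map (K K' : pzRingType) (f : {rmorphism K -> K'}) S M :
  supp S M -> supp S (map_mx f M).
Proof.
by move=> h i j; rewrite mxE => fM; apply: h; apply: contraNneq fM => ->; rewrite rmorph0.
Qed.

(** * Automorphisms *)

Section Elements.
Variable K : comPzRingType.

Definition divad_mx a k : 'M[K]_d := map_mx intr (divad_int a k).
Definition ad_mx l : 'M[K]_d := map_mx intr (ad_int l).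

Definition elt_mx a (t : K) : 'M[K]_d := \sum_(k < d) t ^+ k *: divad_mx a k.

(** The condition [x_i M, v M] = [x_i, v] M on the basis vectors x_i, written
    with the matrices of their adjoint actions. *)
Definition automorphic (M : 'M[K]_d) : Prop :=
  forall l, ad_mx l *m M = M *m \sum_j M l j *: ad_mx j.

Lemma automorphic1 : automorphic 1%:M.
Proof.
move=> l; rewrite mulmx1 mul1mx (bigD1 l) //= mxE eqxx scale1r big1 ?addr0 //.
by move=> j jl; rewrite mxE eq_sym (negPf jl) scale0r.
Qed.

Lemma automorphicM M N : automorphic M -> automorphic N -> automorphic (M *m N).
Proof.
move=> hM hN l; rewrite mulmxA hM -!mulmxA; congr (_ *m _).
rewrite mulmx_suml; under eq_bigr => j _ do rewrite -scalemxAl hN scalemxAr.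
rewrite -mulmx_sumr; congr (_ *m _).
under eq_bigr => j _ do rewrite scaler_sumr; rewrite exchange_big /=.
apply: eq_bigr => k _; rewrite mxE scaler_suml; apply: eq_bigr => j _.
by rewrite scalerA.
Qed.

Lemma sum_triangle (A : zmodType) (g : nat -> nat -> A) D :
  \sum_(m < D) \sum_(k < m.+1) g k (m - k)%N = \sum_(k < D) \sum_(l < D - k) g k l.
Proof.
elim: D => [|D IH]; first by rewrite !big_ord0.
rewrite big_ord_recr /= IH [RHS]big_ord_recr /= subSnn big_ord1.
rewrite [X in _ + X]big_ord_recr /= subnn addrA; congr (_ + _).
rewrite -big_split /=; apply: eq_bigr => k _.
by rewrite subSn ?(ltnW (ltn_ord k)) // big_ord_recr.
Qed.

Lemma sum_trunc (A : zmodType) (g : nat -> A) D D' : (D <= D')%N ->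
  (forall k, (D <= k)%N -> g k = 0) -> \sum_(k < D') g k = \sum_(k < D) g k.
Proof.
move=> DD g0; rewrite (big_ord_widen D' g DD) [RHS]big_mkcond /=.
by apply: eq_bigr => k _; case: ltnP => // /g0.
Qed.

(** The product of the truncated exponentials on the right-hand side is a
    Cauchy product, whose terms are those of the Leibniz rule for the divided
    powers of ad e_a. *)
Lemma elt_automorphic a t : a \in Phi -> automorphic (elt_mx a t).
Proof.
move=> ha l.
pose f k m := divad_mx a k *m \sum_j divad_mx a m l j *: ad_mx j.
have f0 k m : (d <= k)%N || (d <= m)%N -> f k m = 0.
  rewrite /f /divad_mx => /orP[h|h]; first by rewrite (divad_int_nilp ha h) map_mx0 mul0mx.
  by rewrite (divad_int_nilp ha h) map_mx0 big1 ?mulmx0 // => j _; rewrite mxE scale0r.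
have leib m : ad_mx l *m divad_mx a m = \sum_(k < m.+1) f k (m - k)%N.
  rewrite /ad_mx /divad_mx -map_mxM divad_int_leibniz // raddf_sum; apply: eq_bigr => k _.
  rewrite /= map_mxM /f; congr (_ *m _); rewrite raddf_sum; apply: eq_bigr => j _.
  by rewrite /= map_mxZ; congr (_ *: _); rewrite [RHS]mxE.
have -> : ad_mx l *m elt_mx a t =
    \sum_(m < d + d) \sum_(k < m.+1) t ^+ k * t ^+ (m - k) *: f k (m - k)%N.
  transitivity (\sum_(m < d + d) t ^+ m *: (ad_mx l *m divad_mx a m)).
    rewrite /elt_mx mulmx_sumr.
    rewrite (sum_trunc (D := d) (g := fun m => t ^+ m *: (ad_mx l *m divad_mx a m))).
    - by apply: eq_bigr => k _; rewrite scalemxAr.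
    - exact: leq_addr.
    - by move=> k dk; rewrite /divad_mx (divad_int_nilp ha dk) map_mx0 mulmx0 scaler0.
  apply: eq_bigr => m _; rewrite leib scaler_sumr; apply: eq_bigr => k _.
  by rewrite -exprD subnKC // -ltnS.
rewrite (sum_triangle (fun k m => t ^+ k * t ^+ m *: f k m)).
rewrite (sum_trunc (D := d)
  (g := fun k => \sum_(m < d + d - k) t ^+ k * t ^+ m *: f k m)); last first.
- by move=> k dk; rewrite big1 // => m _; rewrite f0 ?dk // scaler0.
- exact: leq_addr.
rewrite {1}/elt_mx mulmx_suml; apply: eq_bigr => k _.
rewrite (sum_trunc (D := d) (g := fun m => t ^+ k * t ^+ m *: f k m)); last first.
- by move=> m dm; rewrite f0 ?dm ?orbT // scaler0.
- by rewrite -addnBA ?leq_addr // ltnW.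
rewrite -scalemxAl.
under eq_bigr => m _ do rewrite -scalerA.
rewrite -scaler_sumr; congr (_ *: _); rewrite /f.
under eq_bigr => m _ do rewrite scalemxAr.
rewrite -mulmx_sumr; congr (_ *m _).
under eq_bigr => m _ do rewrite scaler_sumr; rewrite exchange_big /=.
apply: eq_bigr => j _; rewrite /elt_mx summxE scaler_suml; apply: eq_bigr => m _.
by rewrite scalerA [in RHS]mxE.
Qed.

End Elements.

(** * The cone of positive weights *)

Definition wpos x := npos Delta x && (x != 0).
Definition above a x := wpos (x - a).

Lemma wposD x y : wpos x -> npos Delta y -> wpos (x + y).
Proof.
move=> /andP[hx x0] hy; rewrite /wpos nposD //; apply: contra x0 => /eqP e0.
apply/eqP; apply: (npos_anti baseP hx).
by rewrite (_ : - x = y) // -[y](addKr x) e0 addr0.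
Qed.

Lemma wpos_npos x : wpos x -> npos Delta x. Proof. by case/andP. Qed.

Lemma wpos_ht x : wpos x -> 0 < ht Delta x.
Proof. by move=> /andP[h1 h2]; apply: lt_le_trans (npos_ht_ge1 baseP h1 h2). Qed.

Lemma wpos_root a : posr Phi Delta a -> wpos a.
Proof. by move=> ha; rewrite /wpos (posr_npos ha) (posr_nz rsP ha). Qed.

Lemma wpos_muln a k : wpos a -> (0 < k)%N -> wpos (a *+ k).
Proof.
case: k => // k ha _; elim: k => [//|k IH]; rewrite mulrSr.
by apply: wposD => //; apply: wpos_npos.
Qed.

Lemma above_pos a x : npos Delta a -> above a x -> wpos x.
Proof. by move=> ha hx; rewrite -(subrK a x); apply: wposD. Qed.

Definition upclosed (S : pred V) :=
  (forall x, S x -> wpos x) /\ (forall x y, S x -> npos Delta y -> S (x + y)).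

Lemma upclosed_wpos : upclosed wpos.
Proof. by split=> // x y; apply: wposD. Qed.

Lemma upclosed_above a : npos Delta a -> upclosed (above a).
Proof.
move=> ha; split=> [x|x y hx hy]; first exact: above_pos.
by rewrite /above addrAC; apply: wposD.
Qed.

Section Leading.
Variable K : comPzRingType.
Local Notation divad_mx := (divad_mx K).
Local Notation ad_mx := (ad_mx K).

Lemma divad_mx_supp a k : a \in Phi -> supp (pred1 (a *+ k)) (divad_mx a k).
Proof.
move=> ha i j; rewrite mxE => h; apply/eqP.
have : divad_int a k i j != 0 by apply: contraNneq h => ->.
by move/(divad_int_supp ha) ->; rewrite addrAC subrr add0r.
Qed.

Lemma divad_mx0 a : a \in Phi -> divad_mx a 0 = 1.
Proof. by move=> ha; rewrite /divad_mx divad_int0 // map_mx1. Qed.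

(** The term in t^k has weight k a, which is above a for k >= 2. *)
Lemma elt_lead a (t : K) : posr Phi Delta a ->
  supp (above a) (elt_mx a t - 1 - t *: divad_mx a 1).
Proof.
move=> pa; have ha := posr_root pa; have d2 : (2 <= d)%N.
  exact: ltnW (d_ge3 Delta br e rsP ha).
rewrite /elt_mx (bigID (fun k : 'I_d => (k < 2)%N)) /=.
rewrite -(big_ord_widen d (fun k => t ^+ k *: divad_mx a k) d2).
rewrite big_ord_recl big_ord1 expr0 scale1r divad_mx0 // expr1.
have cancel (u v w : 'M[K]_d) : u + v + w - u - v = w.
  by rewrite -addrA -opprD addrC addKr.
rewrite cancel.
apply: supp_sum => k; rewrite -leqNgt => k2; apply: suppZ.
apply: (supp_sub (@divad_mx_supp _ k ha)) => x /eqP ->.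
have k1 : (0 < k.-1)%N by move: k2; case: (k : nat) => [|[]].
rewrite /above -(ltn_predK k2) mulrSr addrK.
by apply: wpos_muln => //; apply: wpos_root.
Qed.

Lemma elt_ge a (t : K) : posr Phi Delta a ->
  supp (fun x => npos Delta (x - a)) (elt_mx a t - 1).
Proof.
move=> pa; rewrite -[_ - 1](subrK (t *: divad_mx a 1)); apply: suppD.
  by apply: (supp_sub (@elt_lead _ t pa)) => x /wpos_npos.
apply: suppZ; apply: (supp_sub (@divad_mx_supp _ 1 (posr_root pa))) => x /eqP ->.
by rewrite mulr1n subrr npos0.
Qed.

Lemma elt_pos a (t : K) : posr Phi Delta a -> supp wpos (elt_mx a t - 1).
Proof.
move=> pa; apply: (supp_sub (@elt_ge _ t pa)) => x /= hx.
by rewrite -(subrK a x) addrC; apply: wposD => //; apply: wpos_root.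
Qed.

Lemma elt0 a : a \in Phi -> elt_mx a (0 : K) = 1.
Proof.
move=> ha; have d1 : (0 < d)%N by apply: ltn_trans (d_ge3 Delta br e rsP ha).
rewrite /elt_mx (bigD1 (Ordinal d1)) //= expr0 scale1r divad_mx0 // big1 ?addr0 //.
move=> k k0; rewrite expr0n (_ : (k == 0 :> nat) = false) ?scale0r //.
by apply: contraNF k0 => /eqP e0; apply/eqP/val_inj.
Qed.

Lemma ad_mx_supp l : supp (pred1 (wt l)) (ad_mx l).
Proof.
move=> i j; rewrite mxE => h; apply/eqP.
have : ad_int l i j != 0 by apply: contraNneq h => ->.
by move/ad_int_supp ->; rewrite addrAC subrr add0r.
Qed.

(** Comparing the components of minimal weight w in the automorphism condition
    for the Cartan element h_k: the component D of an automorphism 1 + D + ...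
    satisfies w(h_k) D = - ad (D h_k). The terms quadratic in M - 1 have weight
    higher than w. *)
Lemma lead_eq (S : pred V) (M : 'M[K]_d) (w : V) (k : 'I_n) (x y : 'I_d) :
    automorphic M -> supp S (M - 1) -> 0 < ht Delta w ->
    (forall i j : 'I_d, S (wt j - wt i) -> ht Delta w <= ht Delta (wt j - wt i)) ->
    wt y - wt x = w ->
  ((cartan_int (wt x) (al k))%:~R - (cartan_int (wt y) (al k))%:~R) * (M - 1) x y =
    \sum_(j | wt j == w) (M - 1) (ih k) j * ad_mx j x y.
Proof.
move=> autM suppM1 w0 minw hw; set N := M - 1 in suppM1 *.
pose T z := S z && (ht Delta w <= ht Delta z).
have NT : supp T N.
  by move=> i j /suppM1 h; rewrite /T h minw.
pose B := \sum_j N (ih k) j *: ad_mx j.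
have BT : supp T B.
  apply: supp_sum => j _; case: (eqVneq (N (ih k) j) 0) => [->|nz].
    by rewrite scale0r; apply: supp0.
  apply: suppZ; apply: (supp_sub (@ad_mx_supp j)) => z /eqP ->.
  by have := NT _ _ nz; rewrite wt_ih subr0.
have eM : M = 1 + N by rewrite addrC subrK.
have e1 : ad_mx (ih k) *m N = B + N *m ad_mx (ih k) + N *m B.
  have := autM (ih k).
  have -> : \sum_j M (ih k) j *: ad_mx j = ad_mx (ih k) + B.
    rewrite (eq_bigr (fun j => (1 : 'M_d) (ih k) j *: ad_mx j + N (ih k) j *: ad_mx j)).
      2: by move=> j _; rewrite -scalerDl {1}eM [in LHS]mxE.
    rewrite big_split /= (bigD1 (ih k)) //= mxE eqxx scale1r big1 ?addr0 //.
    by move=> j jk; rewrite mxE eq_sym (negPf jk) scale0r.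
  rewrite {1 2}eM mulmxDr mulmx1 mulmxDl mul1mx -addrA => /addrI ->.
  by rewrite mulmxDr addrA.
have hA (z : 'I_d) : ad_mx (ih k) z z = (cartan_int (wt z) (al k))%:~R.
  by rewrite mxE ad_int_h eqxx mul1r.
have hA0 (z z' : 'I_d) : z != z' -> ad_mx (ih k) z z' = 0.
  by move=> zz; rewrite mxE ad_int_h (negPf zz) mul0r.
have EA : (ad_mx (ih k) *m N) x y = (cartan_int (wt x) (al k))%:~R * N x y.
  rewrite mxE (bigD1 x) //= hA big1 ?addr0 // => j jx.
  by rewrite hA0 ?mul0r // eq_sym.
have EN : (N *m ad_mx (ih k)) x y = N x y * (cartan_int (wt y) (al k))%:~R.
  rewrite mxE (bigD1 y) //= hA big1 ?addr0 // => j jy.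
  by rewrite hA0 ?mulr0.
have EB : (N *m B) x y = 0.
  have W : supp (fun z => ht Delta w < ht Delta z) (N *m B).
    by apply: suppM NT BT => z1 z2 /andP[_ h1] /andP[_ h2]; rewrite htD; lra.
  by apply: (suppE W); rewrite hw ltxx.
have := congr1 (fun Z : 'M_d => Z x y) e1.
rewrite EA [RHS]mxE EB addr0 [RHS]mxE EN => e2.
rewrite mulrBl e2 [X in _ - X]mulrC addrK /B summxE.
rewrite [RHS]big_mkcond; apply: eq_bigr => j _; rewrite [LHS]mxE.
case: eqP => // wj; rewrite (suppE (@ad_mx_supp j)) ?mulr0 //=.
by rewrite hw; apply/eqP => e3; apply: wj.
Qed.

End Leading.

(** * Leading components of automorphisms are inner *)

Lemma zc_wt (i : 'I_d) k : (cartan_int (wt i) (al k))%:~R = cartan (wt i) (al k).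
Proof.
case: (idx_cases i) => [[j ->]|[hi _]]; last by rewrite (zcE rsP).
by rewrite wt_ih zc0 /cartan dot0l mulr0 mul0r.
Qed.

Section Domain.
Variable K : idomainType.
Hypothesis char0 : forall c : int, c%:~R = 0 :> K -> c = 0.
Local Notation divad_mx := (divad_mx K).
Variables (S : pred V) (M : 'M[K]_d) (w : V).
Hypotheses (autM : automorphic M) (suppM1 : supp S (M - 1)) (Pw : wpos w)
  (minw : forall i j : 'I_d,
     S (wt j - wt i) -> ht Delta w <= ht Delta (wt j - wt i)).

Let eqM k x y := lead_eq k autM suppM1 (wpos_ht Pw) minw (x := x) (y := y).

Let choose_k : exists (k : 'I_n) (m : int), m != 0 /\ forall x y : 'I_d,
  wt y - wt x = w -> cartan_int (wt x) (al k) - cartan_int (wt y) (al k) = m.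
Proof.
have w0 : 0 < dot w w by rewrite dot_gt0; case/andP: Pw.
have [k /andP[_ hk]] := npos_dot_gt0 baseP (wpos_npos Pw) w0; exists k.
have [/existsP[x0 /existsP[y0 /eqP h0]]|none] :=
    boolP [exists x : 'I_d, exists y : 'I_d, wt y - wt x == w]; last first.
  exists 1; split=> // x y hxy; case/negP: none.
  by apply/existsP; exists x; apply/existsP; exists y; apply/eqP.
exists (cartan_int (wt x0) (al k) - cartan_int (wt y0) (al k)).
have E (x y : 'I_d) : wt y - wt x = w ->
    (cartan_int (wt x) (al k) - cartan_int (wt y) (al k))%:~R = - cartan w (al k).
  by move=> <-; rewrite rmorphB /= !zc_wt cartanBl opprB.
split=> [|x y hxy]; last by apply: (@intr_inj R); rewrite !E.
rewrite -(intr_eq0 R) E // oppr_eq0 /cartan mulf_neq0 ?invr_eq0 //.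
  by rewrite mulf_neq0 ?pnatr_eq0 // lt0r_neq0.
by rewrite lt0r_neq0 // (root_dot_gt0 rsP).
Qed.

(** A derivation of weight w maps h_k to a weight vector of weight w, which
    vanishes when w is neither a root nor 0. *)
Lemma lead_nonroot x y : w \notin Phi -> wt y - wt x = w -> (M - 1) x y = 0.
Proof.
move=> nw hxy; have [k [m [m0 hm]]] := choose_k.
have := eqM k hxy; rewrite -rmorphB /= hm // big1 => [|j /eqP wj].
  move/eqP; rewrite mulf_eq0 => /orP[/eqP/char0 e0|/eqP //].
  by rewrite e0 eqxx in m0.
case: (idx_cases j) => [[l e1]|[hj _]]; last by rewrite -wj hj in nw.
by case/andP: Pw => _; rewrite -wj e1 wt_ih eqxx.
Qed.

(** Some h_k has w(h_k) != 0, and then w(h_k) D is a multiple of ad e_w. The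
    Bezout relation for the entries of ad e_w makes w(h_k) divide the factor,
    so D itself is a multiple of ad e_w over K. *)
Lemma lead_root : w \in Phi -> exists (c : K) (i : 'I_d) (b : 'I_n -> int),
  [/\ wt i = - w, c = \sum_k (b k)%:~R * (M - 1) i (ih k) &
    forall x y, wt y - wt x = w -> (M - 1) x y = c * divad_mx w 1 x y].
Proof.
move=> hw; have pw : posr Phi Delta w by rewrite /posr hw wpos_npos.
have [i [b [wi hb]]] := divad_int_bezout pw.
have [j [_ wj]] := idx_exists Delta br e hw.
have [k [m [m0 hm]]] := choose_k; pose c' := (M - 1) (ih k) j.
have E x y : wt y - wt x = w -> m%:~R * (M - 1) x y = c' * divad_mx w 1 x y.
  move=> hxy; have := eqM k hxy; rewrite -rmorphB /= hm // => ->.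
  rewrite (bigD1 j) ?wj //= big1 ?addr0 => [|l /andP[/eqP wl lj]].
    by rewrite /ad_mx (ad_int_root hw wj).
  by case/eqP: lj; apply: (idx_uniq rsP); rewrite wl // wj.
exists (\sum_k (b k)%:~R * (M - 1) i (ih k)), i, b; split=> // x y hxy.
have hbK : \sum_l (b l)%:~R * divad_mx w 1 i (ih l) = 1.
  transitivity ((\sum_l b l * divad_int w 1 i (ih l))%:~R : K); last by rewrite hb.
  rewrite rmorph_sum; apply: eq_bigr => l _; rewrite rmorphM /=; congr (_ * _).
  by rewrite [LHS]mxE.
have mK : m%:~R != 0 :> K by apply: contra m0 => /eqP/char0 ->.
apply: (mulfI mK); rewrite E // mulrA; congr (_ * _).
rewrite mulr_sumr.
transitivity (\sum_k c' * ((b k)%:~R * divad_mx w 1 i (ih k))).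
  by rewrite -mulr_sumr hbK mulr1.
apply: eq_bigr => l _; rewrite [LHS]mulrCA -E; last by rewrite wt_ih wi sub0r opprK.
by rewrite [RHS]mulrCA.
Qed.

End Domain.

Lemma mulmxB1 (K : pzRingType) (M E : 'M[K]_d) :
  M *m E - 1 = (M - 1) + (E - 1) + (M - 1) *m (E - 1).
Proof.
have H (N G : 'M[K]_d) : (1 + N) *m (1 + G) - 1 = N + G + N *m G.
  rewrite mulmxDl mul1mx mulmxDr mulmx1 addrC !addrA addNr add0r.
  by rewrite [G + N]addrC.
by have := H (M - 1) (E - 1); rewrite ![1 + _]addrC !subrK.
Qed.

(** * The group U *)

Section Group.
Variable F : finFieldType.
Local Notation rsub := (root_subgroup Phi Delta br e F).
Local Notation U := (UY Phi Delta br e F).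
Implicit Types (u v : {perm 'rV[F]_d}) (t : F).

Definition acts_by u (M : 'M[F]_d) := forall v : 'rV_d, u v = v *m M.

(** The only matrix by which u can act. *)
Definition act_mx u : 'M[F]_d := \matrix_(i, j) u (delta_mx 0 i) 0 j.

Lemma act_mxE u M : acts_by u M -> act_mx u = M.
Proof. by move=> h; apply/matrixP => i j; rewrite mxE h -rowE mxE. Qed.

Lemma acts_by_inj u v M : acts_by u M -> acts_by v M -> u = v.
Proof. by move=> hu hv; apply/permP => x; rewrite hu hv. Qed.

Lemma acts_byM u v M N : acts_by u M -> acts_by v N -> acts_by (u * v)%g (M *m N).
Proof. by move=> hu hv x; rewrite permM hv hu mulmxA. Qed.

Lemma acts_by1 : acts_by 1%g 1%:M.
Proof. by move=> x; rewrite perm1 mulmx1. Qed.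

Lemma root_elt_mxE a t : root_elt_mx Phi Delta br e a t = elt_mx a t.
Proof.
apply: eq_bigr => k _; congr (_ *: _); apply/matrixP => i j.
by rewrite !mxE.
Qed.

Lemma rsubP a u : reflect (exists t, acts_by u (elt_mx a t)) (u \in rsub a).
Proof.
rewrite inE; apply: (iffP existsP) => -[t h]; exists t.
  by move=> v; rewrite -root_elt_mxE; apply/eqP; move/forallP: h; apply.
by apply/forallP => v; rewrite root_elt_mxE h.
Qed.

(** The nonzero coordinates of lowest weight of a vector v are also coordinates
    of v M. *)
Lemma unip_inj (M : 'M[F]_d) : supp wpos (M - 1) ->
  injective (fun v : 'rV_d => v *m M).
Proof.
move=> hM; suff inj0 (v : 'rV_d) : v *m M = 0 -> v = 0.
  move=> v v' /= h; apply/eqP; rewrite -subr_eq0; apply/eqP/inj0.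
  by rewrite mulmxBl h subrr.
move=> hv; apply/eqP/negPn/negP => v0.
have [j0 hj0] : exists j, v 0 j != 0.
  apply/existsP; apply: contraR v0 => /existsPn h; apply/eqP/rowP => j.
  by rewrite mxE; apply/eqP; have := h j; rewrite negbK.
case: (@arg_minP _ _ _ j0 (fun j => v 0 j != 0) (fun j : 'I_d => ht Delta (wt j)) hj0) => j hj minj.
have := congr1 (fun z : 'rV_d => z 0 j) hv.
rewrite -[M](subrK 1) mulmxDr mulmx1 !mxE big1 ?add0r => [|i _].
  by move=> e0; rewrite e0 eqxx in hj.
case: (eqVneq ((M - 1) i j) 0) => [->|/hM/wpos_ht]; first by rewrite mulr0.
rewrite htD htN subr_gt0 ltNge => lt.
case: (eqVneq (v 0 i) 0) => [->|vi]; first by rewrite mul0r.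
by rewrite minj in lt.
Qed.

Lemma elt_perm a t : posr Phi Delta a -> exists2 u, u \in rsub a & acts_by u (elt_mx a t).
Proof.
move=> pa; have inj := unip_inj (@elt_pos F a t pa).
have r : acts_by (perm inj) (elt_mx a t) by move=> v; rewrite permE.
by exists (perm inj) => //; apply/rsubP; exists t.
Qed.

Definition gen_above (S : pred V) :=
  <<\bigcup_(a : pos_roots Phi Delta | S (val a)) rsub (val a)>>%G.

Lemma rsub_gen (S : pred V) a : posr Phi Delta a -> S a -> rsub a \subset gen_above S.
Proof.
move=> pa Sa; have ha : a \in pos_roots Phi Delta by rewrite (in_pos baseP).
apply: subset_trans (subset_gen _).
by rewrite (bigcup_sup [` ha]).
Qed.

Section Lift.
Variables (K : idomainType) (phi : {rmorphism K -> F}).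
Hypothesis char0 : forall c : int, c%:~R = 0 :> K -> c = 0.

Lemma map_elt a (T : K) : map_mx phi (elt_mx a T) = elt_mx a (phi T).
Proof.
rewrite /elt_mx raddf_sum; apply: eq_bigr => k _ /=; rewrite map_mxZ rmorphXn.
by congr (_ *: _); apply/matrixP => i j; rewrite !mxE rmorph_int.
Qed.

(** Let u be the reduction of an automorphism M. The component of M of minimal
    weight w is c ad e_w, or 0 when w is not a root, and multiplying M by
    x_w(-c) removes it. If w is in S, this multiplies u by an element of X_w;
    otherwise c has reduction 0, as the component of u of weight w vanishes
    whereas ad e_w does not, and u is unchanged. By induction on the number of
    pairs of basis vectors whose weights differ by an element of the support
    S' of M - 1, one gets to M = 1. *)
Lemma lift_gen (S : pred V) : upclosed S ->
  forall m (S' : pred V) u (M : 'M[K]_d), upclosed S' ->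
    (#|[set ij : 'I_d * 'I_d | S' (wt ij.2 - wt ij.1)%R]| <= m)%N ->
    automorphic M -> acts_by u (map_mx phi M) ->
    supp S' (M - 1) -> supp S (map_mx phi M - 1) -> u \in gen_above S.
Proof.
move=> [SP Sup] m; elim: m => [|m IH] S' u M [S'P S'up] card autM repM' supM supF.
  all: have [/existsP[ij0 hij0]|/existsPn none] :=
    boolP [exists ij : 'I_d * 'I_d, S' (wt ij.2 - wt ij.1)]; last first.
- have M1 : M = 1.
    apply/eqP; rewrite -subr_eq0; apply/eqP/matrixP => i j; rewrite [RHS]mxE.
    by apply: (suppE supM); have := none (i, j).
  by rewrite M1 map_mx1 in repM'; rewrite (acts_by_inj repM' acts_by1) group1.
- move: card; rewrite leqn0 cards_eq0 => /eqP/setP/(_ ij0).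
  by rewrite !inE hij0.
- have M1 : M = 1.
    apply/eqP; rewrite -subr_eq0; apply/eqP/matrixP => i j; rewrite [RHS]mxE.
    by apply: (suppE supM); have := none (i, j).
  by rewrite M1 map_mx1 in repM'; rewrite (acts_by_inj repM' acts_by1) group1.
case: (@arg_minP _ _ _ ij0 (fun ij : 'I_d * 'I_d => S' (wt ij.2 - wt ij.1))
  (fun ij => ht Delta (wt ij.2 - wt ij.1)) hij0) => -[i0 j0] /=.
set w := wt j0 - wt i0 => Sw minw.
have Pw := S'P _ Sw.
have {}minw (i j : 'I_d) : S' (wt j - wt i) -> ht Delta w <= ht Delta (wt j - wt i).
  by move=> h; apply: (minw (i, j) h).
(* Removing only w from S' would not leave an upper set; no difference of
   weights other than w is removed, by minimality of w. *)
pose S2 x := S' x && ~~ npos Delta (w - x).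
have up2 : upclosed S2.
  split=> [x /andP[/S'P]//|x y /andP[hx nx] hy]; rewrite /S2 S'up //=.
  apply: contra nx => h; rewrite (_ : w - x = w - (x + y) + y); first exact: nposD.
  by rewrite opprD addrA subrK.
have card2 : (#|[set ij : 'I_d * 'I_d | S2 (wt ij.2 - wt ij.1)%R]| <= m)%N.
  rewrite -ltnS; apply: leq_trans card; apply: proper_card; apply/properP; split.
    by apply/subsetP => ij; rewrite !inE => /andP[].
  exists (i0, j0); first by rewrite inE.
  by rewrite inE /S2 /= -/w subrr npos0 andbF.
have supp2 (Z : 'M[K]_d) : supp S' Z ->
    (forall x y : 'I_d, wt y - wt x = w -> Z x y = 0) -> supp S2 Z.
  move=> hZ Z0 x y nz; have hxy := hZ _ _ nz; rewrite /S2 hxy /=.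
  apply/negP => hn; have neq : w - (wt y - wt x) != 0.
    by rewrite subr_eq0; apply: contraNneq nz => /esym/Z0 ->.
  have := minw x y hxy; rewrite leNgt -subr_gt0 -htN -htD => /negP; apply.
  by apply: wpos_ht; rewrite /wpos hn.
have [hw|nw] := boolP (w \in Phi); last first.
  apply: (IH S2 u M) => //; apply: supp2 => // x y hxy.
  exact: (lead_nonroot char0 autM supM Pw minw nw hxy).
have pw : posr Phi Delta w by rewrite /posr hw wpos_npos.
have [c [i [b [wi hc hN]]]] := lead_root char0 autM supM Pw minw hw.
have [x xr repx] := elt_perm (phi (- c)) pw.
pose E : 'M[K]_d := elt_mx w (- c); pose M' := M *m E.
have autM' : automorphic M' by apply: automorphicM => //; apply: elt_automorphic.
have Eup (T : pred V) : upclosed T -> T w -> supp T (E - 1).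
  move=> [_ Tup] Tw; apply: (supp_sub (@elt_ge _ _ (- c) pw)) => z hz.
  by rewrite -(subrK w z) addrC Tup.
have supM' : supp S2 (M' - 1).
  apply: supp2; rewrite mulmxB1.
    apply: suppD; first by apply: suppD => //; apply: Eup.
    apply: suppM supM (Eup _ (conj S'P S'up) Sw) => z1 z2 h1 h2.
    by apply: S'up => //; apply/wpos_npos/S'P.
  move=> y z hyz; rewrite mxE mxE hN //.
  have -> : (E - 1) y z = - (c * divad_mx K w 1 y z).
    have := suppE (@elt_lead _ _ (- c) pw) (i := y) (j := z).
    rewrite -/E /above hyz subrr /wpos eqxx andbF => /(_ isT).
    rewrite mxE [X in _ + X]mxE => /eqP; rewrite subr_eq0 => /eqP ->.
    by rewrite mxE mulNr.
  rewrite subrr add0r; apply: suppE.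
    apply: (suppM (W := above w)) supM (@elt_ge _ _ (- c) pw) => z1 z2 h1 h2.
    by rewrite /above -addrA; apply: wposD => //; apply: S'P.
  by rewrite /above hyz subrr /wpos eqxx andbF.
have repM'' : acts_by (u * x)%g (map_mx phi M').
  by rewrite map_mxM map_elt; apply: acts_byM.
have mapB1 (Z : 'M[K]_d) : map_mx phi Z - 1 = map_mx phi (Z - 1).
  by rewrite map_mxB map_mx1.
have [SSw|nSw] := boolP (S w).
  rewrite -(groupMr u (subsetP (rsub_gen pw SSw) _ xr)).
  apply: (IH S2 (u * x)%g M') => //.
  rewrite map_mxM mulmxB1; apply: suppD.
    by apply: suppD => //; rewrite mapB1; apply/supp_map/Eup.
  have sE : supp S (map_mx phi E - 1) by rewrite mapB1; apply/supp_map/Eup.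
  apply: (suppM _ supF sE) => z1 z2 h1 h2.
  by apply: Sup => //; apply/wpos_npos/SP.
have c0 : phi c = 0.
  rewrite hc rmorph_sum big1 // => l _; rewrite rmorphM /=.
  have := suppE supF (i := i) (j := ih l); rewrite mapB1 mxE => -> //.
    by rewrite mulr0.
  by rewrite wt_ih wi sub0r opprK.
have eM' : map_mx phi M' = map_mx phi M.
  by rewrite map_mxM map_elt rmorphN c0 oppr0 elt0 // mulmx1.
by apply: (IH S2 u M') => //; rewrite eM'.
Qed.

End Lift.

(** The indeterminate is sent to a generator of the cyclic group of units. *)
Lemma poly_lift : exists phi : {rmorphism {poly int} -> F},
  forall t, exists T, phi T = t.
Proof.
have /cyclicP[z hz] := field_unit_group_cyclic [set: {unit F}]%G.
pose phi : {rmorphism {poly int} -> F} :=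
  GRing.RMorphism.clone _ _ (horner_eval (val z) \o map_poly intr) _.
exists phi => t; case: (eqVneq t 0) => [->|t0]; first by exists 0; rewrite rmorph0.
have ut : t \is a GRing.unit by rewrite unitfE.
have /cycleP[k hk] : FinRing.unit F ut \in <[z]>%g by rewrite -hz inE.
exists 'X^k.
rewrite rmorphXn /=; have := congr1 val hk; rewrite FinRing.val_unitX /= => ->.
by rewrite /horner_eval map_polyX hornerX.
Qed.

Let poly_char0 (c : int) : c%:~R = 0 :> {poly int} -> c = 0.
Proof. by rewrite -(rmorph_int polyC) intz => /eqP; rewrite polyC_eq0 => /eqP. Qed.

Lemma UY_lift (phi : {rmorphism {poly int} -> F}) :
    (forall t, exists T, phi T = t) ->
  forall u, u \in U -> exists M : 'M[{poly int}]_d,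
    [/\ automorphic M, acts_by u (map_mx phi M) & supp wpos (M - 1)].
Proof.
move=> surj u /gen_prodgP[m [c hc ->]].
elim/big_rec: _ => [|k x _ [M [autM repM' supM]]].
  exists 1; split; [exact: automorphic1 | by rewrite map_mx1; apply: acts_by1 |].
  by rewrite subrr; apply: supp0.
have /bigcupP[[a ha] _ /rsubP[t ht]] := hc k; have [T eT] := surj t.
have pa : posr Phi Delta a by have := ha; rewrite (in_pos baseP).
exists (elt_mx a T *m M); split.
- by apply: automorphicM => //; apply: elt_automorphic (posr_root pa).
- by rewrite map_mxM map_elt eT; apply: acts_byM.
- rewrite mulmxB1; have sE := @elt_pos _ a T pa.
  apply: suppD; first exact: suppD.
  by apply: (suppM _ sE supM) => x1 x2 h1 h2; apply: wposD => //; apply: wpos_npos.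
Qed.

Lemma UY_acts_by u : u \in U -> acts_by u (act_mx u).
Proof.
have [phi surj] := poly_lift.
by move=> /(UY_lift surj)[M [_ hM _]]; rewrite (act_mxE hM).
Qed.

Lemma UY_unip u : u \in U -> supp wpos (act_mx u - 1).
Proof.
have [phi surj] := poly_lift.
move=> /(UY_lift surj)[M [_ hM sM]]; rewrite (act_mxE hM) -[X in _ - X](map_mx1 phi) -map_mxB.
exact: supp_map.
Qed.

Lemma UY_gen (S : pred V) u : upclosed S -> u \in U -> supp S (act_mx u - 1) ->
  u \in gen_above S.
Proof.
have [phi surj] := poly_lift.
move=> upS uU; have [M [autM hM sM]] := UY_lift surj uU; rewrite (act_mxE hM) => sS.
exact: (lift_gen poly_char0 upS upclosed_wpos (leqnn _) autM hM sM sS).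
Qed.

Lemma act_mxM u v : u \in U -> v \in U -> act_mx (u * v)%g = act_mx u *m act_mx v.
Proof. by move=> hu hv; apply/act_mxE/acts_byM; apply: UY_acts_by. Qed.

Lemma act_mx1 : act_mx 1%g = 1.
Proof. exact: act_mxE acts_by1. Qed.

Lemma rsub_UY a : posr Phi Delta a -> rsub a \subset U.
Proof.
move=> pa; have ha : a \in pos_roots Phi Delta by rewrite (in_pos baseP).
by apply: subset_trans (subset_gen _); rewrite (bigcup_sup [` ha]).
Qed.

(** * Characters *)

Section Character.
Variable i : Iirr U.
Local Notation chi := ('chi_i).

(** Z(chi) / ker chi is the center of U / ker chi. *)
Lemma comm_cfker u v : u \in 'Z(chi)%CF -> v \in U -> [~ u, v]%g \in cfker chi.
Proof.
move=> uZ vU; have nK : U \subset 'N(cfker chi)%g by apply: cfker_norm.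
have nZ : 'Z(chi)%CF \subset 'N(cfker chi)%g by apply: subset_trans nK; apply: cfcenter_sub.
have : [~: 'Z(chi)%CF, U]%g \subset cfker chi.
  by rewrite -quotient_cents2 // cfcenter_eq_center subsetIr.
by move/subsetP; apply; apply: mem_commg.
Qed.

Lemma sub_cfcenter (A : {set {perm 'rV[F]_d}}) : A \subset U ->
  (forall u v, u \in A -> v \in U -> [~ u, v]%g \in cfker chi) ->
  A \subset 'Z(chi)%CF.
Proof.
move=> sAU hA; have nK : U \subset 'N(cfker chi)%g by apply: cfker_norm.
have nA := subset_trans sAU nK.
have : (A / cfker chi \subset 'Z('chi_i)%CF / cfker chi)%g.
  rewrite cfcenter_eq_center subsetI quotientS //= quotient_cents2 //.
  by rewrite gen_subG; apply/subsetP => x /imset2P[u v uA vU ->]; apply: hA.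
rewrite quotientSK // mulSGid //.
exact: normal_sub (cfker_center_normal _).
Qed.

End Character.


(** * Leading terms of commutators *)

Local Notation divad_F := (divad_mx F).
Definition from a x := npos Delta (x - a).

Lemma divad_F_from a : a \in Phi -> supp (from a) (divad_F a 1).
Proof.
move=> ha; apply: (supp_sub (@divad_mx_supp _ _ 1 ha)) => x /eqP ->.
by rewrite /from mulr1n subrr npos0.
Qed.

Definition lead a t u := supp (above a) (act_mx u - 1 - t *: divad_F a 1).

Lemma above_from a x : above a x -> from a x.
Proof. exact: wpos_npos. Qed.

Lemma lead_from a t u : a \in Phi -> lead a t u -> supp (from a) (act_mx u - 1).
Proof.
move=> ha h; rewrite -[_ - 1](subrK (t *: divad_F a 1)); apply: suppD.
  exact: supp_sub h (@above_from a).
by apply: suppZ; apply: divad_F_from.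
Qed.

Lemma rsub_lead a t u : posr Phi Delta a -> acts_by u (elt_mx a t) -> lead a t u.
Proof. by move=> pa hu; rewrite /lead (act_mxE hu); apply: elt_lead. Qed.

Lemma from_above g a x y : from g x -> above a y -> above (g + a) (x + y).
Proof. by move=> h1 h2; rewrite /above opprD addrACA addrC; apply: wposD. Qed.

Lemma above_from_add g a x y : above g x -> from a y -> above (g + a) (x + y).
Proof. by move=> h1 h2; rewrite /above opprD addrACA; apply: wposD. Qed.

Lemma from_from g a x y : from g x -> from a y -> from (g + a) (x + y).
Proof. by move=> h1 h2; rewrite /from opprD addrACA; apply: nposD. Qed.

Lemma lead_mul g a (M N A B : 'M[F]_d) :
  supp (above g) (M - A) -> supp (from g) A ->
  supp (above a) (N - B) -> supp (from a) N ->
  supp (above (g + a)) (M *m N - A *m B).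
Proof.
move=> h1 h2 h3 h4.
have -> : M *m N - A *m B = (M - A) *m N + A *m (N - B).
  by rewrite mulmxBl mulmxBr addrA subrK.
by apply: suppD; [apply: suppM h1 h4; apply: above_from_add
                 |apply: suppM h2 h3; apply: from_above].
Qed.

(** If u = 1 + N and v = 1 + N', then u v - v u = N N' - N' N, whose leading term
    is ts [ad e_g, ad e_a]; multiplication by the inverse of v u, which is
    unipotent, does not affect leading terms. *)
Lemma comm_lead g a (c : int) s t u v : g \in Phi -> a \in Phi ->
  divad_int g 1 *m divad_int a 1 - divad_int a 1 *m divad_int g 1 = c *: divad_int (g + a) 1 ->
  u \in U -> v \in U -> lead g t u -> lead a s v ->
  lead (g + a) (t * s * c%:~R) [~ u^-1, v^-1]%g.
Proof.
move=> hg ha hc uU vU hu hv; pose w := [~ u^-1, v^-1]%g.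
have ew : w = (u * v * (u^-1 * v^-1))%g by rewrite /w /commg /conjg !invgK !mulgA.
have QU : (u^-1 * v^-1)%g \in U by rewrite groupM ?groupV.
pose Q := act_mx (u^-1 * v^-1)%g; pose D := act_mx u *m act_mx v - act_mx v *m act_mx u.
have eW : act_mx w - 1 = D *m Q.
  rewrite ew (act_mxM (groupM uU vU) QU) (act_mxM uU vU) /D.
  apply: etrans (esym (mulmxBl _ _ _)); congr (_ - _).
  by rewrite -(act_mxM vU uU) /Q -(act_mxM (groupM vU uU) QU) mulgA mulgK mulgV act_mx1.
have hA := divad_F_from hg; have hB := divad_F_from ha.
have hN := lead_from hg hu; have hN' := lead_from ha hv.
have eD : D = (act_mx u - 1) *m (act_mx v - 1) - (act_mx v - 1) *m (act_mx u - 1).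
  rewrite /D !mulmxBl !mulmxBr !mul1mx !mulmx1 !opprB.
  move: (act_mx u *m act_mx v) (act_mx v *m act_mx u) (act_mx u) (act_mx v) => x y z z'.
  by apply/matrixP => k l; rewrite !mxE; ring.
have eAB : (t *: divad_F g 1) *m (s *: divad_F a 1) - (s *: divad_F a 1) *m (t *: divad_F g 1)
    = (t * s * c%:~R) *: divad_F (g + a) 1.
  rewrite -!scalemxAl -!scalemxAr !scalerA (mulrC s) -scalerBr -!map_mxM -map_mxB hc.
  by rewrite map_mxZ scalerA.
have hD : supp (above (g + a)) (D - (t * s * c%:~R) *: divad_F (g + a) 1).
  rewrite -eAB eD.
  have -> (x y z z' : 'M[F]_d) : x - y - (z - z') = (x - z) - (y - z').
    by apply/matrixP => k l; rewrite !mxE; ring.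
  apply: suppB; first by apply: lead_mul => //; apply: suppZ.
  by rewrite [g + a]addrC; apply: lead_mul => //; apply: suppZ.
have hDf : supp (from (g + a)) D.
  rewrite eD; apply: suppB; first by apply: suppM hN hN'; apply: from_from.
  by rewrite addrC; apply: suppM hN' hN; apply: from_from.
rewrite /lead -/w eW -[Q](subrK 1) mulmxDr mulmx1 -addrA; apply: suppD => //.
apply: (suppM _ hDf (UY_unip QU)) => x y h1 h2.
by rewrite /above addrAC addrC; apply: wposD.
Qed.

Section Comparable.
Variable p : nat.
Hypotheses (hp : p \in [pchar F])
  (coefP : forall g a r, g \in Phi -> a \in Phi -> g + a \in Phi ->
     g - a *+ r \in Phi -> ~~ (p %| r.+1)%N).

(** Let X_a be central modulo the kernel. For a root g > a of maximal height
    among those with X_g not in the kernel, commutators with simple root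
    elements along a chain of roots from a to g produce elements of the kernel
    with every possible leading term at g; the remaining factors of these lie
    in root subgroups above g, hence in the kernel, and so does X_g. *)
Lemma comparable_cfker (i : Iirr U) a b :
  posr Phi Delta a -> posr Phi Delta b -> wpos (b - a) ->
  rsub a \subset 'Z('chi_i)%CF -> rsub b \subset cfker 'chi_i.
Proof.
move=> pa pb hab aZ; apply/negPn/negP => bK.
pose P (x : Phi) := [&& posr Phi Delta (val x), wpos (val x - a) &
  ~~ (rsub (val x) \subset cfker 'chi_i)].
have Pb : P [` posr_root pb] by rewrite /P /= pb hab.
case: (@arg_maxP _ _ _ _ P (fun x => ht Delta (val x)) Pb) => -[g hg] /= /and3P[/= pg hag gK] maxg.
have up g' : posr Phi Delta g' -> above g g' -> rsub g' \subset cfker 'chi_i.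
  move=> pg' gg'; apply/negPn/negP => g'K.
  have /maxg : P [` posr_root pg'].
    rewrite /P /= pg' g'K andbT -(subrK g g') -addrA; apply: wposD => //.
    exact: wpos_npos.
  rewrite leNgt -subr_gt0 -htN -htD => /negP; apply; exact: wpos_ht.
have KZ : cfker 'chi_i \subset 'Z('chi_i)%CF by apply/normal_sub/cfker_center_normal.
have ZU : 'Z('chi_i)%CF \subset U by apply: cfcenter_sub.
pose inK g' := forall t, exists2 u, u \in cfker 'chi_i & lead g' t u.
have step g' k : posr Phi Delta g' -> posr Phi Delta (g' + al k) ->
    (forall t, exists2 u, u \in 'Z('chi_i)%CF & lead g' t u) -> inK (g' + al k).
  move=> pg' pgk hZ t; have hg' := posr_root pg'; have hgk := posr_root pgk.
  have [c [r [hr nc hc]]] := divad_int_comm (alr k) hg' hgk.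
  have c0 : c%:~R != 0 :> F.
    have : r.+1%:R != 0 :> F by rewrite -(dvdn_pcharf hp) (coefP hg' (alr k) hgk hr).
    rewrite -nc; case: (c) => m; first by [].
    by rewrite NegzE mulrNz oppr_eq0.
  have [u uZ hu] := hZ (t / c%:~R).
  have pk := posr_al baseP k.
  have [v vk hv] := elt_perm (1 : F) pk.
  have uU : u \in U by apply: (subsetP ZU).
  have vU : v \in U by apply: (subsetP (rsub_UY pk)).
  exists [~ u^-1, v^-1]%g; first by rewrite comm_cfker ?groupV.
  have := comm_lead hg' (alr k) hc uU vU hu (rsub_lead pk hv).
  by rewrite mulr1 divfK.
have chain : g = a \/ inK g.
  apply: (@chain_ind _ _ _ _ rsP baseP (fun g => g = a \/ inK g) _ a g) => //.
  - move=> g' k pg' pgk [eg|hK]; right; apply: step => // t.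
      rewrite eg; have [u ua hu] := elt_perm t pa.
      by exists u; [apply: (subsetP aZ)|apply: rsub_lead].
    by have [u uK hu] := hK t; exists u => //; apply: (subsetP KZ).
  - exact: wpos_npos.
  - by left.
case: chain => [eg|hK]; first by move: hag; rewrite eg /wpos subrr eqxx andbF.
case/negP: gK; apply/subsetP => x xg; have /rsubP[t hx] := xg.
have [u uK hu] := hK t; have xU : x \in U by apply: (subsetP (rsub_UY pg)).
have uU : u \in U by apply/(subsetP ZU)/(subsetP KZ).
rewrite -(groupMl _ (groupVr uK)).
have yU : (u^-1 * x)%g \in U by rewrite groupM ?groupV.
have genK : gen_above (above g) \subset cfker 'chi_i.
  rewrite gen_subG; apply/bigcupsP => -[g' hg'] /= agg'; apply: up => //.
  by have := hg'; rewrite (in_pos baseP).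
apply: (subsetP genK); apply: UY_gen => //.
  exact: upclosed_above (posr_npos pg).
have -> : act_mx (u^-1 * x)%g - 1 = act_mx u^-1%g *m (act_mx x - act_mx u).
  by rewrite mulmxBr -!act_mxM ?groupV // mulVg act_mx1.
have hD : supp (above g) (act_mx x - act_mx u).
  have -> : act_mx x - act_mx u =
      (act_mx x - 1 - t *: divad_F g 1) - (act_mx u - 1 - t *: divad_F g 1).
    by apply/matrixP => k l; rewrite !mxE; ring.
  by apply: suppB => //; apply: rsub_lead.
rewrite -[act_mx u^-1](subrK 1) mulmxDl mul1mx; apply: suppD => //.
apply: (suppM _ _ hD); last by apply: UY_unip; rewrite groupV.
move=> y z h1 h2; rewrite /above -addrA; apply: wposD => //; exact: wpos_npos.
Qed.

End Comparable.

(** * Congruence subgroups *)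

Definition suppb (S : pred V) (M : 'M[F]_d) :=
  [forall i, forall j, (M i j != 0) ==> S (wt j - wt i)].

Lemma suppbP S M : reflect (supp S M) (suppb S M).
Proof.
apply: (iffP forallP) => h i; last by apply/forallP => j; apply/implyP/h.
by move=> j; have /forallP/(_ j)/implyP := h i.
Qed.

Definition congr_sub (S : pred V) := [set u in U | suppb S (act_mx u - 1)].

Lemma congr_subP S u : reflect (u \in U /\ supp S (act_mx u - 1)) (u \in congr_sub S).
Proof. by rewrite inE; apply: (iffP andP) => -[h /suppbP]. Qed.

Lemma congr_sub_group (S : pred V) : (forall x y, S x -> S y -> S (x + y)) ->
  group_set (congr_sub S).
Proof.
move=> Sadd; apply/group_setP; split=> [|u v /congr_subP[hu su] /congr_subP[hv sv]].
  by apply/congr_subP; split; rewrite ?group1 // act_mx1 subrr; apply: supp0.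
apply/congr_subP; split; first by rewrite groupM.
rewrite act_mxM // mulmxB1; apply: suppD; first exact: suppD.
exact: suppM su sv.
Qed.

(** A commutator of 1 + N and 1 + N' is 1 + (N N' - N' N) up to multiplication by
    unipotent matrices, so its support lies in the upper set generated by the
    sum of those of N and N'. *)
Lemma congr_sub_comm (S T : pred V) u v : upclosed T -> 
  (forall x y, S x -> wpos y -> T (x + y)) -> u \in congr_sub S -> v \in U ->
  [~ u, v]%g \in congr_sub T.
Proof.
move=> [TP Tup] ST /congr_subP[uU su] vU; apply/congr_subP; split.
  by rewrite groupR.
have QU : ((v * u)^-1)%g \in U by rewrite groupV groupM.
have ew : [~ u, v]%g = ((v * u)^-1 * (u * v))%g.
  by rewrite /commg /conjg invMg !mulgA.
have -> : act_mx [~ u, v]%g - 1 =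
    act_mx (v * u)^-1%g *m (act_mx u *m act_mx v - act_mx v *m act_mx u).
  rewrite ew (act_mxM QU (groupM uU vU)) -(act_mxM uU vU) -(act_mxM vU uU) mulmxBr.
  by rewrite -(act_mxM QU (groupM vU uU)) mulVg act_mx1.
have -> : act_mx u *m act_mx v - act_mx v *m act_mx u =
    (act_mx u - 1) *m (act_mx v - 1) - (act_mx v - 1) *m (act_mx u - 1).
  rewrite !mulmxBl !mulmxBr !mul1mx !mulmx1.
  move: (act_mx u *m act_mx v) (act_mx v *m act_mx u) (act_mx u) (act_mx v) => x y z z'.
  by apply/matrixP => k l; rewrite !mxE; ring.
have sv := UY_unip vU.
have sD : supp T ((act_mx u - 1) *m (act_mx v - 1) - (act_mx v - 1) *m (act_mx u - 1)).
  apply: suppB; first exact: suppM su sv.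
  by apply: suppM sv su => x y hx hy; rewrite addrC; apply: ST.
rewrite -[act_mx _](subrK 1) mulmxDl mul1mx; apply: suppD => //.
apply: suppM (UY_unip QU) sD => x y hx hy.
by rewrite addrC; apply: Tup => //; apply: wpos_npos.
Qed.

Lemma congr_sub_norm (S : pred V) : upclosed S -> U \subset 'N(congr_sub S)%g.
Proof.
move=> upS; have [SP Sup] := upS.
have addS x y : S x -> S y -> S (x + y).
  by move=> hx hy; apply: Sup => //; apply/wpos_npos/SP.
pose H := Group (congr_sub_group addS).
apply/subsetP => v vU; rewrite inE; apply/subsetP => _ /imsetP[u uS ->].
have -> : (u ^ v = u * [~ u, v])%g by rewrite /commg mulKVg.
change ((u * [~ u, v])%g \in H); apply: groupM => //.
apply: (congr_sub_comm upS _ uS vU) => x y hx hy.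
by apply: Sup => //; apply: wpos_npos.
Qed.

Section Antichain.
Variable Sigma : {fset V}.
Hypotheses (sSP : forall a, a \in Sigma -> posr Phi Delta a)
  (antiS : forall a b, a \in Sigma -> b \in Sigma -> ~~ wpos (b - a)).

Definition off x := wpos x && [forall s : Sigma, ~~ npos Delta (val s - x)].

Definition offS x := off x || (x \in Sigma).

Lemma offP x : reflect (wpos x /\ forall a, a \in Sigma -> ~~ npos Delta (a - x)) (off x).
Proof.
apply: (iffP andP) => -[h1 h2]; split=> //.
  by move=> a ha; move/forallP/(_ [` ha]): h2.
by apply/forallP => -[a ha] /=; apply: h2.
Qed.

Lemma off_up : upclosed off.
Proof.
split=> [x /andP[]//|x y /offP[hx nx] hy]; apply/offP; split; first exact: wposD.
move=> a /nx; apply: contra => h.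
rewrite (_ : a - x = a - (x + y) + y); first exact: nposD.
by rewrite opprD addrA subrK.
Qed.

Lemma offS_wpos x : offS x -> wpos x.
Proof. by case/orP => [/offP[]//|/sSP/wpos_root]. Qed.

Lemma offS_above x y : offS x -> wpos y -> off (x + y).
Proof.
move=> /orP[hx|hx] hy; first by apply: off_up.2 => //; apply: wpos_npos.
apply/offP; split; first by apply: wposD; [apply/wpos_root/sSP | apply: wpos_npos].
move=> a ha; apply: contra (antiS hx ha) => h.
rewrite (_ : a - x = y + (a - (x + y))); first exact: wposD.
by rewrite [RHS]addrC opprD addrA subrK.
Qed.

Lemma offS_add x y : offS x -> offS y -> offS (x + y).
Proof. by move=> hx /offS_wpos hy; rewrite /offS offS_above. Qed.

Lemma off_add x y : off x -> off y -> off (x + y).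
Proof. by move=> hx /offP[hy _]; apply: off_up.2 => //; apply: wpos_npos. Qed.

Lemma off_Sigma a : a \in Sigma -> ~~ off a.
Proof.
by move=> ha; apply/offP => -[_ /(_ a ha)]; rewrite subrr npos0.
Qed.

Definition offS_group := Group (congr_sub_group offS_add).
Definition off_group := Group (congr_sub_group off_add).

Lemma off_sub_offS : off_group \subset offS_group.
Proof.
apply/subsetP => u /congr_subP[hu su]; apply/congr_subP; split=> //.
by apply: supp_sub su _ => x hx; rewrite /offS hx.
Qed.

Lemma rsub_offS a : a \in Sigma -> rsub a \subset offS_group.
Proof.
move=> ha; have pa := sSP ha; apply/subsetP => u ua; apply/congr_subP; split.
  exact: (subsetP (rsub_UY pa)).
have /rsubP[t hu] := ua; rewrite (act_mxE hu).
apply: supp_sub (@elt_ge _ a t pa) _ => x hx.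
have [e0|nx] := eqVneq (x - a) 0; first by rewrite /offS (subr0_eq e0) ha orbT.
rewrite /offS -(subrK a x) addrC offS_above // /offS ?ha ?orbT //.
by rewrite /wpos hx.
Qed.

(** A fixed entry, at a place where ad e_a has a nonzero one. *)
Definition entry a (M : 'M[F]_d) : F :=
  if [pick ij : 'I_d * 'I_d | divad_F a 1 ij.1 ij.2 != 0] is Some ij
  then M ij.1 ij.2 else 0.

Lemma entryD a M N : entry a (M + N) = entry a M + entry a N.
Proof. by rewrite /entry; case: pickP => [ij _|_]; rewrite ?mxE ?addr0. Qed.

Lemma entryZ a c M : entry a (c *: M) = c * entry a M.
Proof. by rewrite /entry; case: pickP => [ij _|_]; rewrite ?mxE ?mulr0. Qed.

Lemma entry_supp a (S : pred V) M : a \in Phi -> supp S M -> ~~ S a -> entry a M = 0.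
Proof.
move=> ha sM nS; rewrite /entry; case: pickP => [ij nz|//].
by apply: (suppE sM); have /eqP -> := @divad_mx_supp _ _ 1 ha _ _ nz; rewrite mulr1n.
Qed.

Lemma entry_neq0 a : posr Phi Delta a -> entry a (divad_F a 1) != 0.
Proof.
move=> pa; rewrite /entry; case: pickP => [ij //|none].
have [i [b [_ hb]]] := divad_int_bezout pa.
have := congr1 (fun z : int => z%:~R : F) hb.
rewrite rmorph_sum big1 => [/eqP|k _]; first by rewrite eq_sym oner_eq0.
have := none (i, ih k) => /negbFE/eqP; rewrite mxE => e0.
by rewrite rmorphM /= e0 mulr0.
Qed.

(** The components of weights in Sigma are additive on the group of the elements
    supported off the strict down-set of Sigma, because the product of two
    components has a weight off the whole down-set. *)
Definition top_coef u := \sum_(s : Sigma) entry (val s) (act_mx u - 1).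

Lemma top_coefM u v : u \in offS_group -> v \in offS_group ->
  top_coef (u * v)%g = top_coef u + top_coef v.
Proof.
move=> /congr_subP[hu su] /congr_subP[hv sv]; rewrite /top_coef -big_split /=.
apply: eq_bigr => -[a ha] _ /=; rewrite (act_mxM hu hv) mulmxB1 !entryD.
rewrite [X in _ + X](@entry_supp _ off) ?addr0 ?off_Sigma //.
  exact/posr_root/sSP.
by apply: suppM su sv => x y hx /offS_wpos; apply: offS_above.
Qed.

Lemma top_coef1 : top_coef 1%g = 0.
Proof.
have := @top_coefM 1%g 1%g (group1 _) (group1 _); rewrite mulg1 => /eqP.
by rewrite -subr_eq subrr => /eqP.
Qed.

Lemma top_coefV u : u \in offS_group -> top_coef u^-1%g = - top_coef u.
Proof.
move=> uA; apply/eqP; rewrite -addr_eq0 -top_coefM ?groupV // mulVg.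
by rewrite top_coef1.
Qed.

Lemma top_coef_off u : u \in off_group -> top_coef u = 0.
Proof.
move=> /congr_subP[_ su]; rewrite /top_coef big1 // => -[a ha] _ /=.
by apply: entry_supp su (off_Sigma ha); apply/posr_root/sSP.
Qed.

Lemma top_coef_onto a c : a \in Sigma -> exists2 u, u \in rsub a & top_coef u = c.
Proof.
move=> ha; have pa := sSP ha; have nz := entry_neq0 pa.
have [u ua hu] := elt_perm (c / entry a (divad_F a 1)) pa; exists u => //.
rewrite /top_coef (bigD1 [` ha]) //= big1 ?addr0 => [|[b hb] nb].
  rewrite (act_mxE hu) -[_ - 1](subrK (c / entry a (divad_F a 1) *: divad_F a 1)) entryD.
  rewrite entryZ divfK // (@entry_supp _ (above a)) ?add0r //.
  - exact: posr_root pa.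
  - exact: elt_lead.
  - by rewrite /above subrr /wpos eqxx andbF.
rewrite (act_mxE hu); apply: (@entry_supp _ (from a)) => /=.
- exact/posr_root/sSP.
- exact: elt_ge.
- apply: contra (antiS ha hb) => h; apply/andP; split=> //; rewrite subr_eq0.
  by apply: contra nb => /eqP e0; apply/eqP/val_inj.
Qed.

(** The elements of Sigma are the maximal elements of the down-set that they
    generate, so that the X_a (a in Sigma) are central modulo the normal
    subgroup J of the elements supported off this down-set. On the group A of
    the elements supported off the strict down-set, [top_coef] is a
    homomorphism onto F, already when restricted to one X_a. So an irreducible
    character of A with the kernel of [top_coef] in its kernel is either
    trivial, or nontrivial on each X_a. A constituent of the character induced
    to U from one that is not trivial has the required properties. *)
Lemma antichain_character : exists i : Iirr U,
  [/\ congr_sub off \subset cfker 'chi_i,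
      forall a, a \in Sigma -> rsub a \subset 'Z('chi_i)%CF &
      forall a, a \in Sigma -> ~~ (rsub a \subset cfker 'chi_i)].
Proof.
have sAU : offS_group \subset U by apply/subsetP => u /congr_subP[].
have [S0|[a0 ha0]] : (forall a, a \notin Sigma) \/ (exists a, a \in Sigma).
  by case: (fset_0Vmem Sigma) => [->|[a ha]]; [left=> a; rewrite inE|right; exists a].
  exists 0; split=> [|a ha|a ha]; try by have := S0 a; rewrite ha.
  by rewrite cfker_irr0; apply/subsetP => u /congr_subP[].
have Bgrp : group_set [set u in offS_group | top_coef u == 0].
  apply/group_setP; split=> [|u v].
    by apply/setIdP; rewrite group1 top_coef1.
  move=> /setIdP[uA /eqP hu] /setIdP[vA /eqP hv]; apply/setIdP.
  by rewrite groupM // top_coefM // hu hv addr0.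
pose B := Group Bgrp.
have sBA : B \subset offS_group by apply/subsetP => u /setIdP[].
have nBA : (B <| offS_group)%g.
  rewrite /normal sBA; apply/subsetP => v vA; rewrite inE.
  apply/subsetP => _ /imsetP[u /setIdP[uA /eqP hu] ->]; apply/setIdP.
  rewrite groupJ // /conjg !top_coefM ?groupM ?groupV // hu add0r.
  by rewrite top_coefV // addNr eqxx.
have [u1 u1a hu1] := top_coef_onto 1 ha0.
have AB : (offS_group / B)%g != 1%g.
  rewrite -subG1 quotient_sub1 ?normal_norm //; apply/subsetPn.
  exists u1; first exact: (subsetP (rsub_offS ha0)).
  by apply/setIdP => -[_]; rewrite hu1 oner_eq0.
have [k k0] := has_nonprincipal_irr AB.
pose j := mod_Iirr k.
have j0 : j != 0 by rewrite mod_Iirr_eq0.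
have kerB : B \subset cfker 'chi_j by rewrite mod_IirrE // cfker_mod.
have [i ci] := constt_cfInd_irr j sAU; exists i.
have kerJ : congr_sub off \subset cfker 'chi_i.
  apply: subset_trans (cfker_constt _ ci); last by rewrite cfInd_char ?irr_char.
  rewrite cfker_Ind_irr //; apply: gcore_max; last exact: congr_sub_norm off_up.
  apply: subset_trans kerB; apply/subsetP => u uJ.
  by apply/setIdP; rewrite (subsetP off_sub_offS) // top_coef_off.
split=> // a ha.
  apply: subset_trans (rsub_offS ha) _; apply: sub_cfcenter => // u v uA vU.
  by apply: (subsetP kerJ); apply: (congr_sub_comm off_up _ uA vU); apply: offS_above.
apply/negP => aK; case/negP: j0; rewrite -subGcfker.
have aj : rsub a \subset cfker 'chi_j.
  rewrite constt_Ind_Res in ci.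
  apply: subset_trans (cfker_constt _ ci); last by rewrite cfRes_char ?irr_char.
  by rewrite cfker_Res ?irr_char // subsetI rsub_offS.
apply/subsetP => u uA; have [x xa hx] := top_coef_onto (top_coef u) ha.
have xA := subsetP (rsub_offS ha) _ xa.
rewrite -(groupMr u (groupVr (subsetP aj _ xa))); apply: (subsetP kerB).
apply/setIdP; rewrite groupM ?groupV // top_coefM ?groupV // top_coefV //.
by rewrite hx subrr.
Qed.

End Antichain.

End Group.

End RootElements.
Theorem proposition5p16 (R : realType) (n : nat)
    (Phi : {fset 'rV[R]_n}) (Delta : n.-tuple 'rV[R]_n)
    (L : vectType algC) (br : L -> L -> L) (e : 'rV[R]_n -> L)
    (p q : nat) (F : finFieldType) (Sigma : {fset 'rV[R]_n}) :
  root_system Phi -> irreducible_roots Phi -> root_base Phi Delta ->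
  chevalley_basis Phi Delta br e ->
  p \in [pchar F] -> #|F| = q ->
  (type_B Delta \/ type_C Delta \/ type_F4 Delta -> (2 < p)%N) ->
  (type_G2 Delta -> (3 < p)%N) ->
  Sigma `<=` pos_roots Phi Delta ->
  representable Phi Delta br e F Sigma <-> root_antichain Phi Delta Sigma.
Proof.
move=> rsP irr baseP chP pF _ hBCF hG /fsubsetP subS.
have coefP := string_coef_prime rsP baseP irr (pcharf_prime pF) hBCF hG.
have comparable := comparable_cfker rsP baseP chP pF coefP.
have rsE (i : Iirr (UY Phi Delta br e F)) a : a \in rs i =
    [&& posr Phi Delta a, root_subgroup Phi Delta br e F a \subset 'Z('chi_i)%CF &
        ~~ (root_subgroup Phi Delta br e F a \subset cfker 'chi_i)].
  by rewrite /posr -(in_pos baseP) !inE /=.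
have posS a : a \in Sigma -> posr Phi Delta a.
  by move=> /subS; rewrite (in_pos baseP).
split=> [[i <-]|anti].
  have no a b : a \in rs i -> b \in rs i -> a <> b -> ~ root_le Phi Delta a b.
    rewrite !rsE => /and3P[pa aZ _] /and3P[pb _ bK] ab /(root_leP baseP) hab.
    case/negP: bK; apply: (comparable i a b) => //; rewrite /wpos hab subr_eq0.
    by apply/eqP => eba; apply: ab.
  by move=> a b ha hb ab; split; apply: no => // ba; apply: ab.
have antiS a b : a \in Sigma -> b \in Sigma -> ~~ wpos Delta (b - a).
  move=> ha hb; apply/negP => /andP[hab ba].
  have neq : a <> b by move=> eab; rewrite eab subrr eqxx in ba.
  by have [no _] := anti a b ha hb neq; apply/no/(root_leP baseP).
have [i [kerJ cen nker]] := antichain_character rsP baseP chP F posS antiS.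
exists i; apply/fsetP => a; rewrite rsE; apply/and3P/idP => [[pa aZ aK]|ha]; last first.
  by split; [apply: posS | apply: cen | apply: nker].
have [aoff|] := boolP (off Delta Sigma a).
  case/negP: aK; apply: subset_trans kerJ; apply/subsetP => u ua; apply/congr_subP.
  split; first exact: (subsetP (rsub_UY br e baseP F pa) _ ua).
  have /rsubP[t hu] := ua; rewrite (act_mxE hu).
  apply: supp_sub (@elt_ge _ _ _ _ _ _ _ rsP baseP chP _ a t pa) _ => x hx.
  by rewrite -(subrK a x) addrC; apply: (off_up baseP Sigma).2.
move=> /offP noff; have [/existsP[s hs]|/existsPn none] :=
    boolP [exists s : Sigma, npos Delta (val s - a)]; last first.
  case: noff; split; first exact: (wpos_root rsP pa).
  by move=> b hb; have := none [` hb].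
case: s hs => b hb /= hab; have [<-//|neq] := eqVneq b a.
case/negP: (nker b hb); apply: (comparable i a b) => //; first exact: posS.
by rewrite /wpos hab subr_eq0.
Qed.
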